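(* Let $\mu$ be a Borel probability measure on $\mathbb{C}$ with finite $1$-energy, i.e. $\int\int \frac{1}{|z-w|}\,d\mu(z)\,d\mu(w) < \infty$, and suppose that $\mu\{z : V_\mu(z) = 0\} = 0$, where $V_\mu(z) := \int \frac{1}{z-w}\,d\mu(w)$. Let $X_1, X_2, \ldots$ be IID complex random variables with common law $\mu$ and let $f_n(z) := \prod_{j=1}^n (z - X_j)$. Then $\mathcal{Z}(f_n')$ converges in distribution to $\mu$ as $n \to \infty$; that is, the Prohorov distance between the random probability measure $\mathcal{Z}(f_n')$ and $\mu$ converges to $0$ in probability.
   Context: For a non-constant polynomial $f$ of degree $d$, $\mathcal{Z}(f)$ denotes the empirical distribution of its roots, $\mathcal{Z}(f) = \frac{1}{d}\sum_{i=1}^d \delta_{r_i}$, where $r_1,\ldots,r_d$ are the roots of $f$ listed with multiplicity. Here $\mathcal{Z}(f_n')$ is considered for $n \ge 2$. When $\mu$ has finite $1$-energy, $V_\mu(z)$ is well defined (absolutely convergent integral) for $\mu$-almost every $z$, and $V_\mu \in L^1(\mu)$. The Prohorov distance between probability measures $\mu,\nu$ on a separable metric space is the infimum of $\epsilon>0$ such that $\mu(A)\le \nu(A^\epsilon)+\epsilon$ and $\nu(A)\le\mu(A^\epsilon)+\epsilon$ for every Borel set $A$, where $A^\epsilon$ is the set of points within distance $\epsilon$ of some point of $A$; it metrizes weak convergence. The convergence in the theorem is convergence in distribution of random elements of the space of probability measures on $\mathbb{C}$ (with the Prohorov metric) to the deterministic element $\mu$. *)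

(* Defs.v *)
From HB Require Import structures.
From mathcomp Require Import all_boot all_order all_algebra.
From mathcomp Require Import all_classical all_reals all_analysis.
From mathcomp Require Import complex.

Set Implicit Arguments.
Unset Strict Implicit.
Unset Printing Implicit Defensive.

Import Order.TTheory GRing.Theory Num.Theory.
Import numFieldNormedType.Exports.
Import Normc.

Local Open Scope classical_set_scope.
Local Open Scope ring_scope.
Local Open Scope complex_scope.

(* R[i] gets the topology of its modulus and the Borel sigma-algebra of that
   topology. *)
HB.instance Definition _ (R : realType) := NormedModule.copy R[i] R[i]^o.

HB.instance Definition _ (R : realType) :=
  @isMeasurable.Build (sigma_display (@open R[i])) R[i]
    <<s @open R[i] >> (@sigma_algebra0 _ setT _) (@sigma_algebraC _ _)
    (@sigma_algebra_bigcup _ setT _).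

Section potential.
Context {R : realType}.
Implicit Type mu : probability R[i] R.

(* The inverse is that of \bar R, so the integrand is +oo on the diagonal
   z = w; a measure of finite energy has no atom. *)
Definition energy1 mu : \bar R :=
  (\int[mu]_z \int[mu]_w ((normc (z - w))%:E)^-1)%E.

(* Where w |-> 1 / (z - w) is not integrable the value is meaningless; for a
   measure of finite 1-energy this happens only on a mu-null set. *)
Definition potential mu (z : R[i]) : R[i] :=
  (\int[mu]_w complex.Re ((z - w)^-1)) +i* (\int[mu]_w complex.Im ((z - w)^-1)).

End potential.

Section empirical.
Context {R : realType}.

Definition roots_seq (p : {poly R[i]}) : seq R[i] :=
  sval (closed_field_poly_normal p).

Lemma roots_seqE (p : {poly R[i]}) :
  p = lead_coef p *: \prod_(z <- roots_seq p) ('X - z%:P).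
Proof. exact: (svalP (closed_field_poly_normal p)). Qed.

Lemma size_roots_seq (p : {poly R[i]}) :
  p != 0 -> size (roots_seq p) = (size p).-1.
Proof.
move=> p0; rewrite {2}(roots_seqE p) size_scale ?lead_coef_eq0//.
by rewrite size_prod_XsubC.
Qed.

(* A probability measure as soon as p is not constant (root_measure_setT);
   the zero measure if p is a nonzero constant. *)
Definition root_measure (p : {poly R[i]}) : {measure set R[i] -> \bar R} :=
  mscale ((size (roots_seq p))%:R^-1)%:nng
    (msum (fun i => \d_((roots_seq p)`_i)) (size (roots_seq p))).

Lemma root_measureE (p : {poly R[i]}) (A : set R[i]) :
  root_measure p A =
  (((size (roots_seq p))%:R^-1)%:E * \sum_(z <- roots_seq p) \d_z A)%E.
Proof. by rewrite (big_nth 0) big_mkord. Qed.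

Lemma root_measure_setT (p : {poly R[i]}) :
  (1 < size p)%N -> root_measure p [set: R[i]] = 1%E.
Proof.
move=> sp; have p0 : p != 0 by rewrite -size_poly_gt0 (ltn_trans _ sp).
have s0 : ((size (roots_seq p))%:R : R) != 0.
  by rewrite size_roots_seq// pnatr_eq0 -lt0n -ltnS prednK// (ltn_trans _ sp).
rewrite root_measureE (eq_bigr (fun=> 1%E)); last by move=> z _; rewrite diracT.
by rewrite sumEFin -EFinM big_const_seq count_predT iter_addr_0 mulVf.
Qed.

End empirical.

Section prohorov.
Context {R : realType}.
Implicit Types (mu nu : {measure set R[i] -> \bar R}) (A : set R[i]).

Definition enlargement A (e : R) : set R[i] :=
  [set z | exists2 w, A w & normc (z - w) < e].

Definition prohorov mu nu : R :=
  inf [set e : R | 0 < e /\ forall A, measurable A ->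
    (mu A <= nu (enlargement A e) + e%:E)%E /\
    (nu A <= mu (enlargement A e) + e%:E)%E].

End prohorov.

Section random.
Context {d} {T : measurableType d} {R : realType} (P : probability T R).

Definition mutually_independent {d'} {T' : measurableType d'}
    (X : nat -> {RV P >-> T'}) :=
  forall (s : seq nat) (A : nat -> set T'), uniq s ->
    (forall i, measurable (A i)) ->
    P (\bigcap_(i in [set` s]) (X i @^-1` A i)) =
    (\prod_(i <- s) P (X i @^-1` A i))%E.

Definition identically_distributed {d'} {T' : measurableType d'}
    (X : nat -> {RV P >-> T'}) (mu : probability T' R) :=
  forall i (A : set T'), measurable A -> distribution P (X i) A = mu A.

Definition cvg_in_probability (Y : nat -> T -> R) (c : R) :=
  forall e : R, 0 < e -> P [set t | e < `|Y n t - c|] @[n --> \oo] --> 0%E.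

(* X 0, X 1, ... stand for X_1, X_2, ... *)
Definition random_poly (X : nat -> {RV P >-> R[i]}) (n : nat) (t : T) :
  {poly R[i]} := \prod_(j < n) ('X - (X j t)%:P).

End random.

(* Main.v *)
Require Import Defs.
From HB Require Import structures.
From mathcomp Require Import all_boot all_order all_algebra.
From mathcomp Require Import all_classical all_reals all_analysis.
From mathcomp Require Import measurable_realfun complex.
From mathcomp Require Import ring lra.

Set Implicit Arguments.
Unset Strict Implicit.
Unset Printing Implicit Defensive.

Import Order.TTheory GRing.Theory Num.Theory.
Import numFieldNormedType.Exports.
Import Normc.

Local Open Scope classical_set_scope.
Local Open Scope ring_scope.
Local Open Scope complex_scope.

(** Write m = n - 1 and let V be the potential of mu. Near a sample point X_j,
    f'/f is 1/(z - X_j) plus the Cauchy sum S_j(z) of the 1/(z - X_k), k <> j.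
    By the law of large numbers S_j is about m V(X_j), and V(X_j) <> 0 almost
    surely; so f' should vanish near X_j - 1/(m V(X_j)), within O(1/n) of X_j.
    Thus almost all sample points have a critical point close by, the roots of
    f' are spread like the sample, and the sample is spread like mu.

    The deterministic half is [critical_point_near]. If sg <= |S_j(X_j)| and
    32 * sum_k |X_j - X_k|^-2 <= sg^2, then z |-> X_j - 1/S_j(z) contracts the
    disc of centre X_j and radius 2/sg, and its fixed point is a root of f'.
    The same conditions keep the other sample points at distance at least 5/sg
    from X_j, so that the discs of two such good points are disjoint and the
    matching of good points with critical points is injective. Together with a
    covering of most of mu by finitely many small balls this bounds the
    Prohorov distance ([prohorov_nodal_le]); one of the two inequalities in the
    definition of that distance suffices, by taking complements.

    The probabilistic half is [bad_index_rare]: each point is good, with sg a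
    constant times m, up to an event of small probability. Finite 1-energy does
    not make 1/(X_j - X_k) square integrable, so the kernel is truncated to
    distances at least 1/M with M = tau * m. The square of the truncated kernel
    is at most M/|z - w|; hence the variance of S_j/m and the mean of m^-2 times
    the sum of squares are at most of order tau times the energy, which is small
    uniformly in n once tau is small. That some X_k lies within 1/M of X_j has
    probability at most (near_energy M)/tau, which tends to 0 for fixed tau
    because M grows with n. By Markov's inequality few points are bad.

    The event that the Prohorov distance exceeds e is measurable because it is
    the inverse image of an open set of sample points: the roots of f' depend
    continuously on its coefficients ([roots_continuous]) and the distance
    moves by at most e when each root moves by less than e
    ([prohorov_perturb]). *)

(** * The modulus of a complex number *)

Section normc_theory.
Context {R : realType}.
Implicit Types x y z : R[i].

Lemma normc_ge0 x : 0 <= normc x.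
Proof. by case: x => a b; exact: sqrtr_ge0. Qed.

Lemma normc_eq0 x : (normc x == 0) = (x == 0).
Proof. by apply/eqP/eqP => [/eq0_normc//|->]; exact: normc0. Qed.

Lemma normc_gt0 x : (0 < normc x) = (x != 0).
Proof. by rewrite lt_def normc_eq0 normc_ge0 andbT. Qed.

Lemma normcBC x y : normc (x - y) = normc (y - x).
Proof. by rewrite -opprB normcN. Qed.

Lemma le_normc_dist y x z : normc (x - z) <= normc (x - y) + normc (y - z).
Proof. by rewrite (le_trans _ (le_normcD _ _))// addrA subrK. Qed.

Lemma leB_normc x y : normc x - normc y <= normc (x - y).
Proof. by have := le_normcD (x - y) y; rewrite subrK lerBlDr. Qed.

Lemma le_normc_sum (I : Type) (r : seq I) (P : pred I) (F : I -> R[i]) :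
  normc (\sum_(i <- r | P i) F i) <= \sum_(i <- r | P i) normc (F i).
Proof.
elim/big_ind2 : _ => [|u a v b ua vb|//]; first by rewrite normc0.
by rewrite (le_trans (le_normcD _ _))// lerD.
Qed.

Lemma normc_prod (I : Type) (r : seq I) (F : I -> R[i]) :
  normc (\prod_(i <- r) F i) = \prod_(i <- r) normc (F i).
Proof. exact: (big_morph _ (@normcM R) (@normc1 R)). Qed.

Lemma normcX x n : normc (x ^+ n) = normc x ^+ n.
Proof. by elim: n => [|n IH]; [rewrite !expr0 normc1|rewrite !exprS normcM IH]. Qed.

Lemma normr_Re_le x : `|complex.Re x| <= normc x.
Proof.
by case: x => a b /=; rewrite -sqrtr_sqr ler_wsqrtr// lerDl sqr_ge0.
Qed.

Lemma normr_Im_le x : `|complex.Im x| <= normc x.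
Proof.
by case: x => a b /=; rewrite -sqrtr_sqr ler_wsqrtr// lerDr sqr_ge0.
Qed.

Lemma normc_le_ReIm x : normc x <= `|complex.Re x| + `|complex.Im x|.
Proof.
case: x => a b /=.
rewrite -(@ger0_norm _ (`|a| + `|b|)) ?addr_ge0// -sqrtr_sqr ler_wsqrtr//.
rewrite sqrrD !real_normK ?num_real// -addrA lerD2l lerDr.
by rewrite mulrn_wge0// mulr_ge0.
Qed.

End normc_theory.

(** * Continuity of the roots of a polynomial *)
Section root_continuity.
Context {R : realType}.
Implicit Types (a b : R[i]) (s : seq R[i]) (p : {poly R[i]}).

Local Notation monic_of s := (\prod_(z <- s) ('X - z%:P)).

Lemma normc_horner_monic s a :
  normc (monic_of s).[a] = \prod_(z <- s) normc (a - z).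
Proof.
rewrite horner_prod normc_prod; apply: eq_bigr => z _.
by rewrite hornerXsubC.
Qed.

Lemma ler_prod_const (I : eqType) (s : seq I) (F : I -> R) (t : R) :
  0 <= t -> (forall z, z \in s -> t <= F z) ->
  t ^+ size s <= \prod_(z <- s) F z.
Proof.
move=> t0; elim: s => [|z s IH] h; first by rewrite big_nil.
rewrite big_cons exprS ler_pM ?exprn_ge0//; first by rewrite h ?mem_head.
by apply: IH => w ws; rewrite h// inE ws orbT.
Qed.

(** If all the roots were at distance at least t from a, the product of their
    distances to a would be at least t to the power of their number. *)
Lemma small_value_near_root s a (t : R) : 0 <= t ->
  normc (monic_of s).[a] < t ^+ size s -> exists2 b, b \in s & normc (a - b) < t.
Proof.
move=> t0 h; apply/hasP/negPn/negP => /hasPn far.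
move: h; rewrite normc_horner_monic ltNge => /negP; apply.
by apply: ler_prod_const => // z /far; rewrite -leNgt.
Qed.

(** Synthetic division by 'X - b: each coefficient of the quotient is one of the
    dividend plus b times the next coefficient of the quotient, so the bound
    grows by a factor A and a summand k at each of the N steps down from the
    top. *)
Lemma coef_quotient_XsubC_le p b (A k : R) (N i : nat) :
  1 <= A -> normc b <= A -> 0 <= k ->
  (forall j, normc (('X - b%:P) * p)`_j <= k) -> (size p <= i + N)%N ->
  normc p`_i <= k * N%:R * A ^+ N.
Proof.
move=> A1 bA k0 hk; elim: N i => [|N IH] i sp.
  rewrite addn0 in sp; by rewrite nth_default// normc0 mulr0 mul0r.
have -> : p`_i = (('X - b%:P) * p)`_i.+1 + b * p`_i.+1.
  by rewrite mulrBl coefB coefXM coefCM /= subrK.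
have {IH} h : normc p`_i.+1 <= k * N%:R * A ^+ N by rewrite IH// addSnnS.
rewrite (le_trans (le_normcD _ _))//.
have -> : k * N.+1%:R * A ^+ N.+1 = k * A ^+ N.+1 + A * (k * N%:R * A ^+ N).
  by rewrite -natr1 exprS; ring.
rewrite lerD//; first by rewrite (le_trans (hk _))// ler_peMr// exprn_ege1.
by rewrite normcM ler_pM// ?normc_ge0.
Qed.

Lemma normc_horner_le p a (A k : R) (N : nat) :
  1 <= A -> normc a <= A -> 0 <= k -> (forall j, normc p`_j <= k) ->
  (size p <= N)%N -> normc p.[a] <= k * N%:R * A ^+ N.
Proof.
move=> A1 aA k0 hk sp; rewrite (horner_coef_wide _ sp).
rewrite (le_trans (le_normc_sum _ _ _))//.
rewrite (@le_trans _ _ (\sum_(i < N) k * A ^+ N))//; last first.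
  by rewrite sumr_const card_ord -[_ *+ N]mulr_natr mulrAC.
apply: ler_sum => i _; rewrite normcM normcX ler_pM ?exprn_ge0 ?normc_ge0//.
apply: (@le_trans _ _ (A ^+ i)); first by rewrite lerXn2r ?nnegrE ?normc_ge0// (le_trans _ A1).
by rewrite ler_weXn2l// ltnW.
Qed.

Lemma coef_bounded p : exists2 L : R, 0 <= L & forall i, normc p`_i <= L.
Proof.
exists (\sum_(i < size p) normc p`_i); first by apply: sumr_ge0 => i _; exact: normc_ge0.
move=> i; case: (ltnP i (size p)) => [ip|pi]; last first.
  by rewrite nth_default// normc0 sumr_ge0// => j _; exact: normc_ge0.
rewrite (bigD1 (Ordinal ip))//= lerDl sumr_ge0// => j _; exact: normc_ge0.
Qed.

(** A root b of the second polynomial lies close to the first root of the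
    first; after division by the two linear factors the quotients are still
    coefficientwise close, and the rest follows by induction. *)
Lemma roots_continuous s (e : R) : 0 < e ->
  exists2 dl : R, 0 < dl & forall s', size s' = size s ->
    (forall i, normc ((monic_of s)`_i - (monic_of s')`_i) <= dl) ->
    exists2 s'', perm_eq s'' s' & all2 (fun z w => normc (z - w) < e) s s''.
Proof.
move=> e0; elim: s => [|a u [dl dl0 IH]].
  by exists 1 => // s' /size0nil -> _; exists [::].
have [L L0 hL] := coef_bounded (monic_of u).
pose A := normc a + 1; have A1 : 1 <= A by rewrite lerDr normc_ge0.
have A0 : 0 < A by rewrite (lt_le_trans _ A1).
pose N := (size u).+2.
have NA0 : 0 < N%:R * A ^+ N by rewrite mulr_gt0 ?exprn_gt0.
have [k k0 hk] : exists2 k : R, 0 < k & k * N%:R * A ^+ N <= dl.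
  exists (dl / (N%:R * A ^+ N)); first by rewrite divr_gt0.
  by rewrite -[leLHS]mulrA divfK// gt_eqF.
(* The root b is to be found within t of a: e for the conclusion, 1 to keep
   |b| <= A, and the last bound to control (a - b) times the quotient. *)
pose t := Num.min e (Num.min 1 (k / 2 / (L + 1))).
have t0 : 0 < t by rewrite !lt_min e0 ltr01 !divr_gt0//= ltr_wpDl.
have tL : t * L <= k / 2.
  apply: (@le_trans _ _ (k / 2 / (L + 1) * (L + 1))); last first.
    by rewrite divfK// gt_eqF// ltr_wpDl.
  by apply: ler_pM; rewrite ?(ltW t0)// ?lerDl// !ge_min lexx !orbT.
have [h h0 hh] : exists2 h : R, 0 < h & h * N%:R * A ^+ N < t ^+ (size u).+1.
  have tu0 : 0 < t ^+ (size u).+1 by rewrite exprn_gt0.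
  exists (t ^+ (size u).+1 / 2 / (N%:R * A ^+ N)); first by rewrite !divr_gt0.
  rewrite -[ltLHS]mulrA divfK ?gt_eqF//.
  by rewrite ltr_pdivrMr// ltr_pMr// ltr1n.
exists (Num.min h (k / 2)); first by rewrite lt_min h0 divr_gt0.
move=> s' ss' hc.
have hch i : normc ((monic_of (a :: u) - monic_of s')`_i) <= h.
  by rewrite coefB (le_trans (hc i))// ge_min lexx.
have hck i : normc ((monic_of (a :: u) - monic_of s')`_i) <= k / 2.
  by rewrite coefB (le_trans (hc i))// ge_min lexx orbT.
have sN : (size (monic_of (a :: u) - monic_of s')%R <= N)%N.
  by rewrite (leq_trans (size_polyD _ _))// size_polyN !size_prod_XsubC ss' maxnn.
have aA : normc a <= A by rewrite lerDl.
have [b bs' ab] : exists2 b, b \in s' & normc (a - b) < t.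
  apply: small_value_near_root; first exact: ltW.
  rewrite ss' (le_lt_trans _ hh)//.
  have -> : (monic_of s').[a] = - (monic_of (a :: u) - monic_of s').[a].
    by rewrite hornerD hornerN big_cons hornerM hornerXsubC subrr mul0r sub0r opprK.
  by rewrite normcN; apply: normc_horner_le => //; exact: ltW.
have bA : normc b <= A.
  rewrite -[b](subrK a) (le_trans (le_normcD _ _))// addrC lerD2l normcBC.
  by rewrite (le_trans (ltW ab))// !ge_min lexx orbT.
have pb := perm_to_rem bs'.
have eqP' : monic_of s' = ('X - b%:P) * monic_of (rem b s').
  by rewrite (perm_big _ pb) big_cons.
have [|i|s'' ps'' hs''] := IH (rem b s').
- by rewrite size_rem// ss'.
- rewrite -coefB (le_trans _ hk)//.
  apply: (@coef_quotient_XsubC_le _ b) => //; first exact: ltW.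
  + move=> j.
    have -> : ('X - b%:P) * (monic_of u - monic_of (rem b s')) =
        (monic_of (a :: u) - monic_of s') + (a - b)%:P * monic_of u.
      by rewrite eqP' big_cons polyCB; ring.
    rewrite coefD (le_trans (le_normcD _ _))// [k]splitr lerD//.
    rewrite coefCM normcM (le_trans _ tL)// ler_pM ?normc_ge0//.
    exact: ltW.
  + rewrite (leq_trans (size_polyD _ _))// size_polyN !size_prod_XsubC.
    by rewrite size_rem// ss' maxnn /N /= addnS addnC -addnS leq_addr.
- exists (b :: s''); first by rewrite perm_sym (perm_trans pb)// perm_cons perm_sym.
  by rewrite /= hs'' andbT (lt_le_trans ab)// ge_min lexx.
Qed.

End root_continuity.

(** * A critical point near each root *)
Section critical_point.
Context {R : realType}.
Implicit Types (a b z w : R[i]) (s : seq R[i]).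

Lemma horner_deriv_monic s z : z \notin s ->
  (\prod_(b <- s) ('X - b%:P))^`().[z] =
  (\sum_(b <- s) (z - b)^-1) * (\prod_(b <- s) (z - b)).
Proof.
elim: s => [|b s IH]; first by rewrite !big_nil derivC hornerC mul0r.
rewrite inE negb_or => /andP[zb zs].
rewrite !big_cons derivM derivXsubC mul1r hornerD hornerM IH// hornerXsubC.
rewrite horner_prod (eq_bigr (fun b => z - b)) => [|c _]; last by rewrite hornerXsubC.
have zb0 : z - b != 0 by rewrite subr_eq0.
by move: (\sum_(_ <- _) _) (\prod_(_ <- _) _) => x y; field.
Qed.

(** The hypotheses are invariant under scaling of the plane: sg is an inverse
    length. *)
Section contraction.
Variables (a : R[i]) (s : seq R[i]) (sg : R).
Let S z := \sum_(b <- s) (z - b)^-1.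
Let K : R := \sum_(b <- s) ((normc (a - b)) ^+ 2)^-1.
Hypotheses (sg0 : 0 < sg) (as_ : a \notin s).
Hypotheses (Ssg : sg <= normc (S a)) (Ksg : 32 * K <= sg ^+ 2).

Lemma sq_sum_ge0 : 0 <= K.
Proof. by apply: sumr_ge0 => b _; rewrite invr_ge0 sqr_ge0. Qed.

(** Each single term of K is at most sg^2 / 32, and 25 <= 32. *)
Lemma separation_lower b : b \in s -> 5 / sg <= normc (a - b).
Proof.
move=> bs; have ab : 0 < normc (a - b).
  by rewrite normc_gt0 subr_eq0; apply: contraNneq as_ => ->.
have h : 32 <= (sg * normc (a - b)) ^+ 2.
  rewrite exprMn -ler_pdivrMr ?exprn_gt0//; apply: le_trans Ksg.
  rewrite ler_pM2l// /K (big_rem b bs)/= lerDl.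
  by apply: sumr_ge0 => c _; rewrite invr_ge0 sqr_ge0.
rewrite ler_pdivrMr// leNgt; apply/negP => h1.
have : (sg * normc (a - b)) ^+ 2 < 25.
  have -> : 25 = 5 ^+ 2 :> R by ring.
  by rewrite ltrXn2r// ?nnegrE ?mulr_ge0 ?normc_ge0 ?(ltW sg0)// mulrC.
by move=> h2; have := le_lt_trans h h2; lra.
Qed.

Let disc z := normc (z - a) <= 2 / sg.

Lemma disc_dist z b : disc z -> b \in s -> normc (a - b) / 2 <= normc (z - b).
Proof.
rewrite /disc => za bs; have h := separation_lower bs.
have := le_normc_dist z a b; rewrite (normcBC a z).
have e1 : 5 / sg = 5 / 2 * (2 / sg) by field; rewrite gt_eqF.
have := normc_ge0 (z - a).
by rewrite e1 in h; move: za h; set t := 2 / sg => *; lra.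
Qed.

Lemma separation_gt0 b : b \in s -> 0 < normc (a - b).
Proof. by move=> bs; rewrite (lt_le_trans _ (separation_lower bs))// divr_gt0. Qed.

Lemma disc_notin z : disc z -> z \notin s.
Proof.
move=> dz; apply/negP => zs; have := disc_dist dz zs.
rewrite subrr normc0 leNgt => /negP; apply.
by rewrite divr_gt0// separation_gt0.
Qed.

Lemma cauchy_lip z w : disc z -> disc w -> normc (S z - S w) <= 4 * K * normc (z - w).
Proof.
move=> dz dw; rewrite /S -sumrB (le_trans (le_normc_sum _ _ _))//.
rewrite /K mulr_sumr mulr_suml big_seq [leRHS]big_seq; apply: ler_sum => b bs.
have zb : z - b != 0 by rewrite subr_eq0; apply: contraNneq (disc_notin dz) => ->.
have wb : w - b != 0 by rewrite subr_eq0; apply: contraNneq (disc_notin dw) => ->.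
have -> : (z - b)^-1 - (w - b)^-1 = (w - z) * ((z - b)^-1 * (w - b)^-1).
  by field; rewrite zb wb.
rewrite normcM mulrC (normcBC w) ler_wpM2r ?normc_ge0//.
rewrite normcM !normcV.
have -> : 4 * (normc (a - b) ^+ 2)^-1 = (normc (a - b) / 2)^-1 * (normc (a - b) / 2)^-1.
  by field; rewrite gt_eqF// separation_gt0.
have d0 := separation_gt0 bs.
by rewrite ler_pM ?invr_ge0 ?normc_ge0// lef_pV2 ?disc_dist// posrE ?normc_gt0// divr_gt0.
Qed.

Lemma disc_center : disc a.
Proof. by rewrite /disc subrr normc0 divr_ge0// ltW. Qed.

Lemma cauchy_lower z : disc z -> sg / 2 <= normc (S z).
Proof.
move=> dz; have h := cauchy_lip disc_center dz.
have h1 := leB_normc (S a) (S z).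
have h2 : 4 * K * normc (a - z) <= 4 * K * (2 / sg).
  by rewrite ler_wpM2l ?mulr_ge0 ?sq_sum_ge0// normcBC.
have h3 : 4 * K * (2 / sg) <= sg / 4.
  have -> : 4 * K * (2 / sg) = (32 * K) / (4 * sg) by field; rewrite gt_eqF.
  rewrite ler_pdivrMr ?mulr_gt0//; apply: (le_trans Ksg).
  by rewrite le_eqVlt; apply/orP; left; apply/eqP; field.
have h4 := le_trans h (le_trans h2 h3).
by move: h1 h4 Ssg sg0 => *; lra.
Qed.

Lemma cauchy_neq0 z : disc z -> S z != 0.
Proof. by move=> dz; rewrite -normc_gt0 (lt_le_trans _ (cauchy_lower dz))// divr_gt0. Qed.

Let T z := a - (S z)^-1.

(** As S stays above sg/2 in modulus on the disc, 1/S does not exceed the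
    radius. *)
Lemma newton_disc z : disc z -> disc (T z).
Proof.
move=> dz; rewrite /disc /T addrAC subrr sub0r normcN normcV.
rewrite -[leRHS]invf_div lef_pV2 ?posrE ?cauchy_lower ?divr_gt0//.
by rewrite normc_gt0 cauchy_neq0.
Qed.

Lemma newton_lip z w : disc z -> disc w -> normc (T z - T w) <= normc (z - w) / 2.
Proof.
move=> dz dw.
have -> : T z - T w = (S z - S w) * ((S z)^-1 * (S w)^-1).
  by rewrite /T; field; rewrite !cauchy_neq0.
rewrite normcM normcM !normcV.
apply: (@le_trans _ _ (4 * K * normc (z - w) * ((sg / 2)^-1 * (sg / 2)^-1))).
  apply: ler_pM; rewrite ?mulr_ge0 ?invr_ge0 ?normc_ge0 ?cauchy_lip//.
  by apply: ler_pM; rewrite ?invr_ge0 ?normc_ge0// lef_pV2 ?cauchy_lower//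
     posrE ?divr_gt0// normc_gt0 cauchy_neq0.
have -> : 4 * K * normc (z - w) * ((sg / 2)^-1 * (sg / 2)^-1) =
  (32 * K) / sg ^+ 2 * (normc (z - w) / 2) by field; rewrite gt_eqF.
rewrite ler_piMl ?divr_ge0 ?normc_ge0//.
by rewrite ler_pdivrMr ?exprn_gt0// mul1r.
Qed.

Let u k := iter k T a.

Lemma iterate_disc k : disc (u k).
Proof. by elim: k => [|k]; [exact: disc_center|rewrite /u iterS => /newton_disc]. Qed.

Lemma iterate_step k : normc (u k - u k.+1) <= 2 / sg / 2 ^+ k.
Proof.
elim: k => [|k IH].
  by rewrite expr0 divr1 normcBC; exact: (iterate_disc 1).
rewrite {1 2}/u iterS [iter k.+2 _ _]iterS.
rewrite (le_trans (newton_lip (iterate_disc k) (iterate_disc k.+1)))//.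
by rewrite exprSr invfM mulrA ler_pM2r ?invr_gt0.
Qed.

Let f := ('X - a%:P) * \prod_(b <- s) ('X - b%:P).

(** f' is the product of the z - b times 1 + (z - a) S(z), and the second factor
    is S(z) (z - T(z)). *)
Lemma deriv_iterate k :
  f^`().[u k] = \prod_(b <- s) (u k - b) * S (u k) * (u k - u k.+1).
Proof.
have uk := iterate_disc k.
rewrite /f derivM derivXsubC mul1r hornerD hornerM hornerXsubC.
rewrite horner_deriv_monic ?disc_notin//.
rewrite horner_prod (eq_bigr (fun b => u k - b)) => [|c _]; last by rewrite hornerXsubC.
rewrite [u k.+1]/u iterS -[iter k _ _]/(u k) /T -/(S (u k)).
have := cauchy_neq0 uk; move: (S _) (\prod_(_ <- _) _) => x y x0.
by field.
Qed.

Lemma deriv_iterate_small (e : R) : 0 < e -> exists k, normc f^`().[u k] < e.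
Proof.
move=> e0.
pose q := \prod_(b <- s) (normc (a - b) + 2 / sg).
pose t := normc (S a) + 4 * K * (2 / sg).
have q0 : 0 <= q.
  by apply: prodr_ge0 => b _; rewrite addr_ge0 ?normc_ge0// divr_ge0// ltW.
have t0 : 0 <= t.
  by rewrite addr_ge0 ?normc_ge0// mulr_ge0 ?divr_ge0 ?(ltW sg0)// mulr_ge0// sq_sum_ge0.
pose v := q * t * (2 / sg).
have r0 : 0 <= 2 / sg by rewrite divr_ge0// ltW.
have v0 : 0 <= v by rewrite /v mulr_ge0// mulr_ge0.
have h k : normc f^`().[u k] <= v / 2 ^+ k.
  rewrite deriv_iterate !normcM -[_ / _]mulrA; apply: ler_pM; rewrite ?mulr_ge0 ?normc_ge0//.
    apply: ler_pM; rewrite ?normc_ge0//.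
      rewrite normc_prod /q; apply: ler_prod => b _; rewrite normc_ge0/=.
      by rewrite (le_trans (le_normc_dist a _ _))// addrC lerD2l; exact: iterate_disc.
    rewrite -[S (u k)](subrK (S a)) (le_trans (le_normcD _ _))// addrC lerD2l.
    rewrite (le_trans (cauchy_lip (iterate_disc k) disc_center))//.
    by rewrite ler_wpM2l ?mulr_ge0 ?sq_sum_ge0//; exact: iterate_disc.
  exact: iterate_step.
exists (Num.truncn (v / e)).+1; rewrite (le_lt_trans (h _))//.
rewrite ltr_pdivrMr ?exprn_gt0// mulrC -ltr_pdivrMr//.
rewrite (@lt_trans _ _ (Num.truncn (v / e)).+1%:R)//.
  by rewrite truncnS_gt.
by rewrite -natrX ltr_nat ltn_expl.
Qed.

(** The critical points of f in the disc are the fixed points of the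
    contraction z |-> a - 1/S(z). Instead of taking the limit of its iterates,
    one uses that f' is arbitrarily small along them, while |f'| would be
    bounded below on the disc if all the roots of f' were outside. *)
Lemma critical_point_near :
  exists2 w, root f^`() w & normc (w - a) <= 2 / sg.
Proof.
have [rs ers] := closed_field_poly_normal f^`().
have lc0 : lead_coef f^`() != 0.
  rewrite lead_coef_eq0; apply/eqP => f0.
  have : f^`().[u 0] = 0 by rewrite f0 horner0.
  rewrite deriv_iterate; apply/eqP; rewrite !mulf_neq0 ?cauchy_neq0 ?iterate_disc//.
    rewrite prodf_seq_neq0; apply/allP => b bs /=; rewrite subr_eq0.
    by apply: contraNneq as_ => ->.
  rewrite /u /= /T opprB addrC subrK invr_neq0// cauchy_neq0// disc_center//.
have [/hasP[w ws wa]|/hasPn far] := boolP (has (fun w => normc (w - a) <= 2 / sg) rs).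
  exists w => //; rewrite ers rootZ// root_prod_XsubC//.
have [g g0 hg] : exists2 g : R, 0 < g & forall w, w \in rs -> g <= normc (w - a) - 2 / sg.
  elim: rs far {ers} => [|w rs IH] far; first by exists 1.
  have [|g g0 hg] := IH; first by move=> z zs; apply: far; rewrite inE zs orbT.
  exists (Num.min g (normc (w - a) - 2 / sg)).
    by rewrite lt_min g0 subr_gt0 ltNge far ?mem_head.
  move=> z; rewrite inE => /predU1P[->|/hg zg]; first by rewrite ge_min lexx orbT.
  by rewrite ge_min zg.
have [k] := @deriv_iterate_small (normc (lead_coef f^`()) * g ^+ size rs)
  (mulr_gt0 (etrans (normc_gt0 _) lc0) (exprn_gt0 _ g0)).
have -> z : f^`().[z] = lead_coef f^`() * (\prod_(w <- rs) ('X - w%:P)).[z].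
  by rewrite {1}ers hornerZ.
rewrite normcM ltr_pM2l ?normc_gt0//.
rewrite normc_horner_monic ltNge => /negP; case.
apply: ler_prod_const => [|w /hg wg]; first exact: ltW.
rewrite (le_trans wg)// lerBlDr (normcBC (u k)) (le_trans (le_normc_dist (u k) _ _))//.
by rewrite lerD2l; exact: iterate_disc.
Qed.

End contraction.
End critical_point.

(** * The Borel structure of the complex plane *)
Section borel.
Context {R : realType}.
Implicit Types (x y z : R[i]) (A : set R[i]).

Lemma nbhs_normcP x A :
  nbhs x A <-> exists2 r : R, 0 < r & forall y, normc (x - y) < r -> A y.
Proof.
split.
  move=> /nbhs_ballP[r /= r0 h]; exists (complex.Re r).
    by move: r0; rewrite ltcE /= => /andP[].
  move=> y xy; apply: h; rewrite -ball_normE /=.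
  have -> : r = (complex.Re r)%:C by rewrite RRe_real// gtr0_real.
  by rewrite ltcR.
move=> [r r0 h]; apply/nbhs_ballP; exists r%:C; first by rewrite /= ltcR.
move=> y; rewrite -ball_normE /= => xy; apply: h.
by move: xy; rewrite -ltcR.
Qed.

Lemma open_normcP A : open A <->
  forall x, A x -> exists2 r : R, 0 < r & forall y, normc (x - y) < r -> A y.
Proof.
rewrite openE; split=> h x Ax.
  by apply/nbhs_normcP; exact: h.
by apply/nbhs_normcP; exact: h.
Qed.

Definition cball (x : R[i]) (r : R) : set R[i] := [set y | normc (x - y) < r].

Lemma open_cball x r : open (cball x r).
Proof.
apply/open_normcP => y; rewrite /cball /= => xy.
exists (r - normc (x - y)); first by rewrite subr_gt0.
by move=> z yz; rewrite (le_lt_trans (le_normc_dist y _ _))// -ltrBrDl.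
Qed.

Lemma open_measurableC A : open A -> measurable A.
Proof. by move=> oA; apply: sub_sigma_algebra. Qed.

Lemma measurable_cball x r : measurable (cball x r).
Proof. by apply: open_measurableC; exact: open_cball. Qed.

Lemma open_enlargement A (e : R) : open (enlargement A e).
Proof.
apply/open_normcP => z [w Aw zw].
have [|r r0 hr] := (open_normcP (cball w e)).1 (@open_cball w e) z.
  by rewrite /cball/= normcBC.
exists r => // y /hr; rewrite /cball/= normcBC => ?; by exists w.
Qed.

Lemma measurable_enlargement A (e : R) : measurable (enlargement A e).
Proof. by apply: open_measurableC; exact: open_enlargement. Qed.

(** The value 0 at the integers that encode no pair is again a rational point. *)
Definition rat_point (k : nat) : R[i] :=
  if unpickle k is Some (p, q) then (ratr p : R) +i* (ratr q : R) else 0.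

Lemma rat_point_dense z (e : R) : 0 < e -> exists k, normc (rat_point k - z) < e.
Proof.
move=> e0; have e2 : 0 < e / 2 by rewrite divr_gt0.
have approx (t : R) : exists p : rat, `|ratr p - t| < e / 2.
  have [p] := @rat_in_itvoo R (t - e / 2) (t + e / 2) ltac:(lra).
  by rewrite in_itv/= => h; exists p; rewrite ltr_distl h.
have [p hp] := approx (complex.Re z); have [q hq] := approx (complex.Im z).
exists (pickle (p, q)); rewrite /rat_point pickleK.
rewrite (le_lt_trans (normc_le_ReIm _))// [e]splitr.
by case: z hp hq => a b /= hp hq; rewrite ltrD.
Qed.

End borel.

(** * Bounds on the Prohorov distance *)
Section prohorov_bound.
Context {R : realType}.
Implicit Types (mu nu rho : {measure set R[i] -> \bar R}).

Definition dominated mu nu (e : R) :=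
  forall A, measurable A -> (mu A <= nu (enlargement A e) + e%:E)%E.

(** The complement of the enlargement of A has an enlargement disjoint from A,
    so for measures of total mass 1 the two conditions on e are equivalent. *)
Lemma dominated_sym mu nu (e : R) : mu setT = 1%E -> nu setT = 1%E ->
  dominated mu nu e -> dominated nu mu e.
Proof.
move=> mu1 nu1 h A mA.
have mE := measurable_enlargement A e.
have compl (m : {measure set R[i] -> \bar R}) B : m setT = 1%E -> measurable B ->
    m B \is a fin_num /\ m (~` B) = (1 - m B)%E.
  move=> m1 mB.
  have fB : m B \is a fin_num.
    rewrite ge0_fin_numE// (@le_lt_trans _ _ (m setT))//; last by rewrite m1 ltry.
    by apply: le_measure; rewrite ?inE.
  split => //; rewrite -m1 -(setUv B) measureU//; last 2 first.
  - exact: measurableC.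
  - by rewrite setICr.
  by rewrite addeAC subee ?add0e.
have [fA cA] := compl nu _ nu1 mA; have [fE cE] := compl mu _ mu1 mE.
have := h _ (measurableC mE); rewrite cE => h1.
have h2 : (nu (enlargement (~` enlargement A e) e) <= nu (~` A))%E.
  apply: le_measure; rewrite ?inE//.
  - exact: measurable_enlargement.
  - exact: measurableC.
  move=> z [w wE zw] Az; apply: wE; exists z => //; by rewrite normcBC.
have := le_trans h1 (leeD2r _ h2); rewrite cA.
rewrite -(fineK fA) -(fineK fE) -!EFinB -!EFinD !lee_fin; lra.
Qed.

Lemma prohorov_le mu nu (e : R) : mu setT = 1%E -> nu setT = 1%E -> 0 < e ->
  dominated mu nu e -> prohorov nu mu <= e.
Proof.
move=> mu1 nu1 e0 h; apply: ge_inf.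
  by exists 0 => x [/ltW].
split=> // A mA; split; last exact: h.
exact: (dominated_sym mu1 nu1 h).
Qed.

Lemma prohorov_ge0 mu nu : 0 <= prohorov mu nu.
Proof.
rewrite /prohorov; set E := (X in inf X).
have [->|/set0P E0] := eqVneq E set0; first by rewrite inf0.
by apply: lb_le_inf => // x [/ltW].
Qed.

Lemma prohorov_has_inf mu nu : mu setT = 1%E -> nu setT = 1%E ->
  has_inf [set e : R | 0 < e /\ forall A, measurable A ->
    (mu A <= nu (enlargement A e) + e%:E)%E /\
    (nu A <= mu (enlargement A e) + e%:E)%E].
Proof.
move=> mu1 nu1; split; last by exists 0 => x [/ltW].
have le1 (m : {measure set R[i] -> \bar R}) A : m setT = 1%E -> measurable A ->
    (m A <= 1)%E.
  by move=> <- mA; apply: le_measure; rewrite ?inE.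
exists 1; split=> // A mA; split.
  by apply: (le_trans (le1 _ _ mu1 mA)); rewrite leeDr.
by apply: (le_trans (le1 _ _ nu1 mA)); rewrite leeDr.
Qed.

(** The hypothesis on mu and nu holds when nu is obtained from mu by moving
    each atom by less than e. *)
Lemma prohorov_perturb mu nu rho (e : R) :
  mu setT = 1%E -> nu setT = 1%E -> rho setT = 1%E -> 0 < e ->
  (forall A, (mu A <= nu (enlargement A e))%E) ->
  prohorov nu rho <= prohorov mu rho + e.
Proof.
move=> mu1 nu1 rho1 e0 h; rewrite -lerBlDr; apply: lb_le_inf.
  by have [] := prohorov_has_inf mu1 rho1.
move=> x [x0 hx]; rewrite lerBlDr; apply: prohorov_le => //; first by rewrite addr_gt0.
move=> A mA; have [_ h1] := hx _ mA; apply: (le_trans h1).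
have h2 : (mu (enlargement A x) <= nu (enlargement A (x + e)))%E.
  apply: (le_trans (h _)); apply: le_measure; rewrite ?inE; try exact: measurable_enlargement.
  move=> z [y [w Aw yw] zy]; exists w => //.
  by rewrite (le_lt_trans (le_normc_dist y _ _))// addrC ltrD.
apply: leeD => //; by rewrite lee_fin lerDl ltW.
Qed.

End prohorov_bound.

(** * Root measures and nearby roots *)
Section root_measures.
Context {R : realType}.
Implicit Types (p : {poly R[i]}) (A : set R[i]).

Lemma root_measure_count p A :
  root_measure p A =
    ((count [pred z | `[< A z >]] (roots_seq p))%:R / (size (roots_seq p))%:R)%:E.
Proof.
rewrite root_measureE [in RHS]mulrC EFinM; congr (_ * _)%E.
elim: (roots_seq p) => [|z s IH]; first by rewrite big_nil.
rewrite big_cons IH /= natrD EFinD; congr (_ + _)%E.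
Qed.

Lemma root_measure_ge p A (s : seq R[i]) : (1 < size p)%N -> uniq s ->
  (forall z, z \in s -> root p z) -> (forall z, z \in s -> A z) ->
  (((size s)%:R / ((size p).-1)%:R)%:E <= root_measure p A)%E.
Proof.
move=> sp us rs As; have p0 : p != 0 by rewrite -size_poly_gt0 (ltn_trans _ sp).
rewrite root_measure_count size_roots_seq// lee_fin ler_wpM2r ?invr_ge0// ler_nat.
rewrite -size_filter uniq_leq_size// => z zs.
rewrite mem_filter /= (asboolT (As _ zs))/=.
by have := rs _ zs; rewrite {1}[p]roots_seqE rootZ ?lead_coef_eq0// root_prod_XsubC.
Qed.

End root_measures.

(** * Critical points of a polynomial with well separated roots *)
Section good_roots.
Context {R : realType} (n : nat) (x : nat -> R[i]).
Implicit Types (j k : 'I_n) (c : R) (A : set R[i]).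

Definition cauchy_sum j : R[i] := \sum_(k < n | k != j) (x j - x k)^-1.
Definition riesz_sum j : R := \sum_(k < n | k != j) (normc (x j - x k) ^+ 2)^-1.

(** These are the hypotheses under which the disc of radius 2/sg around x j
    contains a critical point. *)
Definition good (sg : R) j :=
  [/\ forall k, k != j -> x j <> x k, sg <= normc (cauchy_sum j)
    & 32 * riesz_sum j <= sg ^+ 2].

Definition nodal : {poly R[i]} := \prod_(j < n) ('X - (x j)%:P).

Let others j := [seq x k | k <- enum 'I_n & k != j].

Let big_others (T : Type) (idx : T) (op : Monoid.com_law idx) (F : R[i] -> T) j :
  \big[op/idx]_(b <- others j) F b = \big[op/idx]_(k < n | k != j) F (x k).
Proof. by rewrite big_map big_filter big_enum_cond. Qed.

Let good_notin sg j : good sg j -> x j \notin others j.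
Proof.
move=> [h _ _]; apply/negP => /mapP[k]; rewrite mem_filter => /andP[kj _].
exact: h.
Qed.

Lemma good_separated sg j k : 0 < sg -> good sg j -> k != j ->
  5 / sg <= normc (x j - x k).
Proof.
move=> sg0 gj kj; have nj := good_notin gj; case: gj => _ h2 h3.
apply: (@separation_lower _ (x j) (others j)) => //; first by rewrite big_others.
by apply/mapP; exists k => //; rewrite mem_filter kj mem_enum.
Qed.

Lemma good_critical_point sg j : 0 < sg -> good sg j ->
  exists2 w, root nodal^`() w & normc (w - x j) <= 2 / sg.
Proof.
move=> sg0 gj; have nj := good_notin gj; case: gj => _ h2 h3.
have := @critical_point_near _ (x j) (others j) sg sg0 nj.
rewrite !big_others => /(_ h2 h3) [w hw wj]; exists w => //.
by rewrite /nodal (bigD1 j).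
Qed.

Lemma size_nodal_deriv : size nodal^`() = n.
Proof.
have sn : size nodal = n.+1.
  by rewrite size_prod_XsubC /= -[index_enum _]enumT -cardE card_ord.
have [n0|n0] := posnP n.
  rewrite /nodal; case: n / (esym n0); by rewrite big_ord0 derivC size_poly0.
rewrite /deriv size_poly_eq ?sn//= prednK// mulrn_eq0 negb_or -lt0n n0/=.
have -> : nodal`_n = lead_coef nodal by rewrite /lead_coef sn.
by rewrite lead_coef_eq0 -size_poly_eq0 sn.
Qed.

(** Two good points are at distance at least 5/sg, more than twice the radius
    2/sg of the discs around them; so distinct good points yield distinct
    critical points. *)
Lemma root_measure_nodal_ge sg (G : {set 'I_n}) A : (1 < n)%N -> 0 < sg ->
  (forall j, j \in G -> good sg j) ->
  (forall j, j \in G -> forall w, normc (w - x j) <= 2 / sg -> A w) ->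
  ((#|G|%:R / n.-1%:R)%:E <= root_measure nodal^`() A)%E.
Proof.
move=> n1 sg0 hG hA.
have /choice[w hw] : forall j : 'I_n, exists z : R[i],
    j \in G -> root nodal^`() z /\ normc (z - x j) <= 2 / sg.
  move=> j; have [jG|jG] := boolP (j \in G); last by exists 0.
  by have [z hz zj] := good_critical_point sg0 (hG _ jG); exists z.
have winj : {in enum G &, injective w}.
  move=> j k; rewrite !mem_enum => jG kG wjk.
  apply/eqP; apply: contraTT isT => jk.
  have d := good_separated sg0 (hG _ kG) jk.
  have [_ dj] := hw _ jG; have [_ dk] := hw _ kG.
  rewrite wjk normcBC in dj *; rewrite normcBC in dk.
  have t := le_normc_dist (w k) (x k) (x j).
  have s0 : 0 < 1 / sg by rewrite divr_gt0.
  have e5 : 5 / sg = 5 * (1 / sg) by rewrite mulrA mulr1.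
  have e2 : 2 / sg = 2 * (1 / sg) by rewrite mulrA mulr1.
  by rewrite normcBC in dj; rewrite e5 in d; rewrite e2 in dj dk; lra.
have := @root_measure_ge _ nodal^`() A [seq w j | j <- enum G].
rewrite size_map -cardE size_nodal_deriv; apply=> //.
- by rewrite map_inj_in_uniq// enum_uniq.
- by move=> z /mapP[j]; rewrite mem_enum => /hw[? _] ->.
- by move=> z /mapP[j]; rewrite mem_enum => jG ->; apply: (hA _ jG); have [] := hw _ jG.
Qed.

Lemma root_measure_nodalT : (1 < n)%N -> root_measure nodal^`() setT = 1%E.
Proof. by move=> n1; rewrite root_measure_setT// size_nodal_deriv. Qed.

End good_roots.

Section deterministic.
Context {R : realType} (mu : {measure set R[i] -> \bar R}) (mu1 : mu setT = 1%E).

Definition rat_cover (K : nat) (r : R) : set R[i] := \bigcup_(i in `I_K) cball (rat_point i) r.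

Definition rat_subcover (K : nat) (r : R) (I : {set 'I_K}) : set R[i] :=
  \bigcup_(i in [set` I]) cball (rat_point i) r.

Lemma measurable_rat_cover K r : measurable (rat_cover K r).
Proof. by apply: bigcup_measurable => i _; exact: measurable_cball. Qed.

Lemma measurable_rat_subcover K r (I : {set 'I_K}) : measurable (rat_subcover r I).
Proof. apply: fin_bigcup_measurable => // i _; exact: measurable_cball. Qed.

(** Among the sample points in the balls that meet A all but few are good,
    and the critical point attached to a good one lies in the enlargement. *)
Lemma prohorov_nodal_le (n : nat) (x : nat -> R[i]) (K : nat) (sg e dl : R) :
  (1 < n)%N -> 0 < sg -> 0 < e -> 3 * dl <= e -> 2 / sg <= e / 4 ->
  (mu (~` rat_cover K (e / 4)) <= dl%:E)%E ->
  (forall I : {set 'I_K}, (mu (rat_subcover (e / 4) I) <=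
     (#|[set j : 'I_n | `[< rat_subcover (e / 4) I (x j) >]]%SET|%:R / n.-1%:R + dl)%:E)%E) ->
  #|[set j : 'I_n | ~~ `[< good x sg j >]]%SET|%:R <= dl * n.-1%:R ->
  prohorov (root_measure (nodal n x)^`()) mu <= e.
Proof.
move=> n1 sg0 e0 dle sge hcov hsub hbad.
apply: prohorov_le => //; first exact: root_measure_nodalT.
move=> A mA; set r := e / 4 in hcov hsub sge *.
have m0 : 0 < n.-1%:R :> R by rewrite ltr0n -subn1 subn_gt0.
pose I : {set 'I_K} := [set i : 'I_K | `[< exists2 a, A a & cball (rat_point i) r a >]]%SET.
have h1 : (mu A <= mu (rat_subcover r I) + dl%:E)%E.
  apply: (@le_trans _ _ (mu (rat_subcover r I `|` ~` rat_cover K r))).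
    apply: le_measure; rewrite ?inE//.
      apply: measurableU; first exact: measurable_rat_subcover.
      by apply: measurableC; exact: measurable_rat_cover.
    move=> a Aa; have [[i iK ia]|] := pselect (rat_cover K r a); last by right.
    left; exists (Ordinal iK) => //=; rewrite inE; apply/asboolP; by exists a.
  rewrite (le_trans (measureU2 _ _ _))//.
  - exact: measurable_rat_subcover.
  - by apply: measurableC; exact: measurable_rat_cover.
  - by rewrite leeD2l.
set U := [set j : 'I_n | `[< rat_subcover r I (x j) >]]%SET.
set B := [set j : 'I_n | ~~ `[< good x sg j >]]%SET.
have h2 : ((#|U :\: B|%:R / n.-1%:R)%:E <= root_measure (nodal n x)^`() (enlargement A e))%E.
  apply: (root_measure_nodal_ge n1 sg0).
    by move=> j; rewrite !inE negbK => /andP[/asboolP].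
  move=> j; rewrite !inE negbK => /andP[_ /asboolP[i /= ]].
  rewrite inE => /asboolP[a Aa ia] ij w wj; exists a => //.
  rewrite /cball/= in ia ij.
  rewrite (le_lt_trans (le_normc_dist (x j) _ _))//.
  have t := le_normc_dist (rat_point i) (x j) a; rewrite normcBC in ij.
  have : r = e / 4 by []. lra.
have h3 : #|U|%:R <= #|U :\: B|%:R + #|B|%:R :> R.
  rewrite -natrD ler_nat -(cardsID B U) addnC leq_add2l.
  by rewrite subset_leq_card// subsetIr.
apply: (le_trans h1); apply: (le_trans (leeD2r _ (hsub I))).
apply: (le_trans _ (leeD2r _ h2)); rewrite -!EFinD lee_fin.
have h4 : #|U|%:R / n.-1%:R <= #|U :\: B|%:R / n.-1%:R + dl :> R.
  rewrite ler_pdivrMr// mulrDl divfK ?gt_eqF//.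
  by rewrite (le_trans h3)// lerD2l.
rewrite -/U; lra.
Qed.

End deterministic.

(** * Measurability of the Prohorov distance *)
Section coef_continuity.
Context {R : realType}.

Lemma nodalS (n : nat) (x : nat -> R[i]) :
  nodal n.+1 x = nodal n x * ('X - (x n)%:P).
Proof. by rewrite /nodal big_ord_recr. Qed.

(** Induction on the number of roots: the last factor is moved last. *)
Lemma nodal_continuous (n : nat) (x : nat -> R[i]) (e : R) : 0 < e ->
  exists2 dl : R, 0 < dl & forall y : nat -> R[i],
    (forall k, (k < n)%N -> normc (x k - y k) < dl) ->
    forall i, normc ((nodal n x)`_i - (nodal n y)`_i) <= e.
Proof.
elim: n e => [|n IH] e e0.
  by exists 1 => // y _ i; rewrite /nodal !big_ord0 subrr normc0 ltW.
pose a := normc (x n) + 2; have a0 : 0 < a by rewrite ltr_wpDl ?normc_ge0.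
have [L L0 hL] := coef_bounded (nodal n x).
have [|dl dl0 hdl] := IH (e / 2 / a); first by rewrite !divr_gt0.
have L1 : 0 < L + 1 by rewrite ltr_wpDl.
exists (Num.min dl (Num.min 1 (e / 2 / (L + 1)))).
  by rewrite !lt_min dl0 ltr01 !divr_gt0.
move=> y hy i.
have hn k : (k < n)%N -> normc (x k - y k) < dl.
  by move=> kn; have := hy k (ltnW kn); rewrite lt_min => /andP[].
have := hy n (ltnSn n); rewrite !lt_min => /andP[_ /andP[xy1 xyL]].
have -> : (nodal n.+1 x)`_i - (nodal n.+1 y)`_i =
    (((nodal n x - nodal n y) * 'X)`_i - y n * ((nodal n x)`_i - (nodal n y)`_i))
    + (y n - x n) * (nodal n x)`_i.
  have polE : nodal n.+1 x - nodal n.+1 y = ((nodal n x - nodal n y) * 'X -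
      (y n)%:P * (nodal n x - nodal n y)) + (y n - x n)%:P * nodal n x.
    by rewrite !nodalS polyCB; ring.
  by rewrite -coefB polE coefD coefB !coefCM coefB.
rewrite (le_trans (le_normcD _ _))// [leRHS]splitr lerD//.
  rewrite (le_trans (le_normcD _ _))// normcN normcM.
  apply: (@le_trans _ _ (e / 2 / a + (normc (x n) + 1) * (e / 2 / a))).
    apply: lerD.
      rewrite coefMX; case: ifP => _; first by rewrite normc0 !divr_ge0// ltW.
      by rewrite coefB; exact: hdl.
    apply: ler_pM; rewrite ?normc_ge0 ?hdl//.
    have := leB_normc (y n) (x n); rewrite normcBC; lra.
  rewrite le_eqVlt; apply/orP; left; apply/eqP; rewrite /a; field.
  by rewrite gt_eqF// -/a.
rewrite normcM normcBC.
apply: (@le_trans _ _ (e / 2 / (L + 1) * (L + 1))); last by rewrite divfK ?gt_eqF.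
by apply: ler_pM; rewrite ?normc_ge0 ?(ltW xyL)// (le_trans (hL i))// lerDl.
Qed.

Lemma lead_coef_nodal_deriv (n : nat) (x : nat -> R[i]) :
  lead_coef (nodal n x)^`() = n%:R.
Proof.
rewrite /lead_coef size_nodal_deriv coef_deriv.
case: n => [|n]; first by rewrite /nodal big_ord0 -polyC1 coefC.
rewrite /=; have -> : (nodal n.+1 x)`_n.+1 = lead_coef (nodal n.+1 x).
  by rewrite /lead_coef size_prod_XsubC /= -[index_enum _]enumT -cardE card_ord.
by rewrite (monicP (monic_prod_XsubC _ _ _)).
Qed.

Lemma prohorov_nodal_continuous (mu : {measure set R[i] -> \bar R}) (n : nat)
    (x : nat -> R[i]) (e : R) : mu setT = 1%E -> (1 < n)%N -> 0 < e ->
  exists2 dl : R, 0 < dl & forall y : nat -> R[i],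
    (forall k, (k < n)%N -> normc (x k - y k) < dl) ->
    prohorov (root_measure (nodal n x)^`()) mu <=
    prohorov (root_measure (nodal n y)^`()) mu + e.
Proof.
move=> mu1 n1 e0.
have n0 : (n%:R : R[i]) != 0 by rewrite pnatr_eq0 -lt0n ltnW.
have monE z : \prod_(w <- roots_seq (nodal n z)^`()) ('X - w%:P) =
    (n%:R)^-1 *: (nodal n z)^`() :> {poly R[i]}.
  by rewrite {2}[(nodal n z)^`()]roots_seqE lead_coef_nodal_deriv scalerA mulVf// scale1r.
have sz z : size (roots_seq (nodal n z)^`()) = n.-1.
  by rewrite size_roots_seq ?size_nodal_deriv// -size_poly_gt0 size_nodal_deriv ltnW.
have [d d0 hd] := roots_continuous (roots_seq (nodal n x)^`()) e0.
have [dl dl0 hdl] := nodal_continuous n x d0.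
exists dl => // y xy; have {}hdl := hdl _ xy.
have [|i|s ps hs] := hd (roots_seq (nodal n y)^`()); first by rewrite !sz.
  rewrite !monE -coefB -scalerBr coefZ coefB !coef_deriv -mulrnBl.
  have [ni|iN] := leqP n i.
    have big z : (nodal n z)`_i.+1 = 0.
      rewrite nth_default// size_prod_XsubC /= -[index_enum _]enumT -cardE card_ord.
      by rewrite ltnS.
    by rewrite !big subrr mul0rn mulr0 normc0 ltW.
  rewrite -[X in normc (_ * X)]mulr_natr mulrCA normcM -[leRHS]mulr1 ler_pM ?normc_ge0//.
  rewrite normcM normcV -!(rmorph_nat (real_complex R)).
  have nn (k : nat) : normc (k%:R : R)%:C = k%:R :> R.
    by rewrite /= expr0n addr0 sqrtr_sqr ger0_norm.
  by rewrite !nn mulrC ler_pdivrMr ?ltr0n ?(ltnW n1)// mul1r ler_nat.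
apply: (prohorov_perturb (root_measure_nodalT y n1) (root_measure_nodalT x n1) mu1 e0).
move=> A; rewrite !root_measure_count !sz lee_fin ler_wpM2r ?invr_ge0// ler_nat.
rewrite -(permP ps); move: hs; elim: (roots_seq _) s {ps} => [|z u IH] [|w v]//=.
move=> /andP[zw /IH]; apply: leq_add.
case: asboolP => // Aw; rewrite (@asboolT (enlargement A e z))//.
by exists w.
Qed.

End coef_continuity.

Section measurability.
Context d (T : measurableType d) {R : realType} (X : nat -> T -> R[i]).
Hypothesis mX : forall k, measurable_fun setT (X k).

(** An open set of n-tuples is a countable union of products of rational
    balls. *)
Lemma measurable_open_family (n : nat) (G : set (nat -> R[i])) :
  (forall x, G x -> exists2 dl : R, 0 < dl & forall y : nat -> R[i],
    (forall k, (k < n)%N -> normc (x k - y k) < dl) -> G y) ->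
  measurable [set t | G (X ^~ t)].
Proof.
move=> Gopen.
pose box (s : seq nat) (i : nat) : set (nat -> R[i]) :=
  [set x | forall k, (k < n)%N -> cball (rat_point (nth 0%N s k)) i.+1%:R^-1 (x k)].
have -> : [set t | G (X ^~ t)] = \bigcup_(q in [set q : seq nat * nat | box q.1 q.2 `<=` G])
    \bigcap_(k in `I_n) X k @^-1` cball (rat_point (nth 0%N q.1 k)) q.2.+1%:R^-1.
  apply/seteqP; split => [t /= Gt|t [[s i] /= sG ti]]; last by apply: sG.
  have [dl dl0 hdl] := Gopen _ Gt.
  have [i hi] : exists i : nat, i.+1%:R^-1 < dl / 2.
    exists (Num.truncn (dl / 2)^-1); rewrite invf_plt ?posrE ?divr_gt0//.
    exact: truncnS_gt.
  have /choice[c hc] : forall k, exists j, normc (rat_point j - X k t) < i.+1%:R^-1.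
    by move=> k; apply: rat_point_dense; rewrite invr_gt0.
  exists (mkseq c n, i) => /=; last by move=> k /= kn; rewrite nth_mkseq//; exact: hc.
  move=> y hy; apply: hdl => k kn; have := hy k kn; rewrite nth_mkseq// /cball/= => h1.
  rewrite (le_lt_trans (le_normc_dist (rat_point (c k)) _ _))// [dl]splitr.
  by apply: ltrD; [rewrite normcBC (lt_trans (hc k))|rewrite (lt_trans h1)].
rewrite bigcup_mkcond; apply: countable_bigcupT_measurable => //= -[s i].
case: ifP => // _; apply: bigcap_measurableType => k _.
rewrite -[X in measurable X]setTI; apply: mX => //; exact: measurable_cball.
Qed.

Lemma measurable_prohorov_gt (mu : {measure set R[i] -> \bar R}) (n : nat) (e : R) :
  mu setT = 1%E -> (1 < n)%N ->
  measurable [set t | e < prohorov (root_measure (nodal n (X ^~ t))^`()) mu].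
Proof.
move=> mu1 n1; apply: (@measurable_open_family n
  [set x | e < prohorov (root_measure (nodal n x)^`()) mu]) => x /= ex.
rewrite -subr_gt0 in ex.
have [|dl dl0 h] := @prohorov_nodal_continuous R mu n x
  ((prohorov (root_measure (nodal n x)^`()) mu - e) / 2) mu1 n1.
  by rewrite divr_gt0.
have aux (p q : R) : 0 < p - e -> p <= q + (p - e) / 2 -> e < q by lra.
by exists dl => // y /h; exact: aux.
Qed.

End measurability.

(** * Measurable functions of complex variables *)
Section measurable_complex.
Context {R : realType}.

(** The inverse images of the open half-lines are open. *)
Lemma measurable_lipschitz (f : R[i] -> R) :
  (forall z w, `|f z - f w| <= normc (z - w)) -> measurable_fun setT f.
Proof.
move=> lip; apply: (measurability _ (RGenOInfty.measurableE R)).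
move=> /= _ [_ [a ->]] <-; apply: measurableI => //; apply: open_measurableC.
apply/open_normcP => z; rewrite /= in_itv/= andbT => az.
exists (f z - a); first by rewrite subr_gt0.
move=> w zw; rewrite /= in_itv/= andbT.
by have := le_lt_trans (lip z w) zw; rewrite ltr_norml => /andP[_]; lra.
Qed.

Lemma measurable_Re : measurable_fun setT (@complex.Re R).
Proof.
by apply: measurable_lipschitz => -[a b] [c d]; exact: (normr_Re_le ((a +i* b) - (c +i* d))).
Qed.

Lemma measurable_Im : measurable_fun setT (@complex.Im R).
Proof.
by apply: measurable_lipschitz => -[a b] [c d]; exact: (normr_Im_le ((a +i* b) - (c +i* d))).
Qed.

Lemma measurable_sqrtr : measurable_fun setT (@Num.sqrt R).
Proof. by apply: continuous_measurable_fun; exact: sqrt_continuous. Qed.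

(** On the nonnegative half-line the inverse is the power function of exponent
    -1, which is measurable; the maximum extends it to the real line. *)
Lemma measurable_pinv : measurable_fun setT (fun x : R => (Num.max x 0)^-1).
Proof.
have -> : (fun x : R => (Num.max x 0)^-1) = (fun x => Num.max x 0 `^ (-1)).
  by apply/funext => x; rewrite powR_inv1// le_max lexx orbT.
apply: (@measurableT_comp _ _ _ _ _ _ (fun a : R => a `^ (-1)) _
  (fun x : R => Num.max x 0)); first exact: measurable_powR.
exact: measurable_maxr.
Qed.

End measurable_complex.

Section measurable_family.
Context d (T : measurableType d) {R : realType} (f g : T -> R[i]).
Hypotheses (mf : measurable_fun setT f) (mg : measurable_fun setT g).

Let mReB : measurable_fun setT (fun t => complex.Re (f t) - complex.Re (g t)).
Proof.
by apply: measurable_funB; apply: (measurableT_comp (@measurable_Re R)).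
Qed.

Let mImB : measurable_fun setT (fun t => complex.Im (f t) - complex.Im (g t)).
Proof.
by apply: measurable_funB; apply: (measurableT_comp (@measurable_Im R)).
Qed.

Let msq : measurable_fun setT (fun t => (complex.Re (f t) - complex.Re (g t)) ^+ 2 +
   (complex.Im (f t) - complex.Im (g t)) ^+ 2).
Proof. by apply: measurable_funD; exact: measurable_funX. Qed.

Lemma measurable_normcB : measurable_fun setT (fun t => normc (f t - g t)).
Proof.
have -> : (fun t => normc (f t - g t)) = (fun t => Num.sqrt (
   (complex.Re (f t) - complex.Re (g t)) ^+ 2 +
   (complex.Im (f t) - complex.Im (g t)) ^+ 2)).
  by apply/funext => t; case: (f t) (g t) => a b [c e].
exact: (measurableT_comp measurable_sqrtr).
Qed.

Let minv : measurable_fun setT (fun t => ((complex.Re (f t) - complex.Re (g t)) ^+ 2 +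
   (complex.Im (f t) - complex.Im (g t)) ^+ 2)^-1).
Proof.
rewrite [X in measurable_fun _ X](_ : _ = (fun x : R => (Num.max x 0)^-1) \o
   (fun t => (complex.Re (f t) - complex.Re (g t)) ^+ 2 +
   (complex.Im (f t) - complex.Im (g t)) ^+ 2)).
  exact: (measurableT_comp measurable_pinv).
by apply/funext => t /=; rewrite max_l// addr_ge0 ?sqr_ge0.
Qed.

Lemma measurable_normcBV : measurable_fun setT (fun t => (normc (f t - g t))^-1).
Proof.
rewrite [X in measurable_fun _ X](_ : _ = (fun x : R => (Num.max x 0)^-1) \o
   (fun t => normc (f t - g t))).
  by apply: (measurableT_comp measurable_pinv); exact: measurable_normcB.
by apply/funext => t /=; rewrite max_l// normc_ge0.
Qed.

Lemma measurable_ReBV : measurable_fun setT (fun t => complex.Re ((f t - g t)^-1)).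
Proof.
rewrite [X in measurable_fun _ X](_ : _ = (fun t =>
   (complex.Re (f t) - complex.Re (g t)) *
   ((complex.Re (f t) - complex.Re (g t)) ^+ 2 +
   (complex.Im (f t) - complex.Im (g t)) ^+ 2)^-1)).
  exact: measurable_funM.
by apply/funext => t; case: (f t) (g t) => a b [c e].
Qed.

Lemma measurable_ImBV : measurable_fun setT (fun t => complex.Im ((f t - g t)^-1)).
Proof.
rewrite [X in measurable_fun _ X](_ : _ = (fun t =>
   - ((complex.Im (f t) - complex.Im (g t)) *
   ((complex.Re (f t) - complex.Re (g t)) ^+ 2 +
   (complex.Im (f t) - complex.Im (g t)) ^+ 2)^-1))).
  by apply: measurable_funN; exact: measurable_funM.
apply/funext => t; case: (f t) (g t) => a b [c e] //=.
Qed.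

End measurable_family.

(** * Joint laws of independent variables *)
Section joint_law.

(** Rectangles are stable under intersection and generate the product
    sigma-algebra. *)
Lemma measure_prod_unique d1 d2 (T1 : measurableType d1) (T2 : measurableType d2)
    (R : realType) (m m' : {measure set (T1 * T2) -> \bar R}) :
  (m setT < +oo)%E ->
  (forall A B, measurable A -> measurable B -> m (A `*` B) = m' (A `*` B)) ->
  forall X, measurable X -> m X = m' X.
Proof.
move=> moo mm'.
pose C : set (set (T1 * T2)) :=
  [set C | exists A, measurable A /\ exists B, measurable B /\ C = A `*` B].
have CI : setI_closed C.
  move=> /= _ _ [X1 [mX1 [X2 [mX2 ->]]]] [Y1 [mY1 [Y2 [mY2 ->]]]].
  rewrite -setXI; exists (X1 `&` Y1); split; first exact: measurableI.
  by exists (X2 `&` Y2); split => //; exact: measurableI.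
move=> X mX; apply: (measure_unique C (fun n => setT)) => //.
- rewrite measurable_prod_measurableType //; congr (<<s _ >>).
  rewrite predeqE; split => [[A mA [B mB <-]]|[A [mA [B [mB ->]]]]].
    by exists A; split => //; exists B.
  by exists A => //; exists B.
- by move=> n; exists setT; split => //; exists setT; split => //; rewrite setXTT.
- by rewrite bigcup_const.
- by move=> A [A1 [mA1 [A2 [mA2 ->]]]]; exact: mm'.
Qed.

Context d (T : measurableType d) d' (S : measurableType d') {R : realType}
  (P : probability T R) (mu : probability S R) (X : nat -> {RV P >-> S}).
Hypotheses (iX : mutually_independent X) (dX : identically_distributed X mu).

Let PX i (A : set S) : measurable A -> P (X i @^-1` A) = mu A.
Proof. by move=> mA; rewrite -(dX i mA). Qed.

Let mXi i (A : set S) : measurable A -> measurable (X i @^-1` A).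
Proof. by move=> mA; rewrite -[X in measurable X]setTI; apply: measurable_funP. Qed.

Lemma pair_rect i j (A B : set S) : i != j -> measurable A -> measurable B ->
  P (X i @^-1` A `&` X j @^-1` B) = (mu A * mu B)%E.
Proof.
move=> ij mA mB; pose F l := if l == i then A else B.
have us : uniq [:: i; j] by rewrite /= inE ij.
have mF l : measurable (F l) by rewrite /F; case: ifP.
have := iX us mF; rewrite !big_cons big_nil mule1.
have -> : F i = A by rewrite /F eqxx.
have -> : F j = B by rewrite /F eq_sym (negbTE ij).
rewrite !PX// => <-; congr (P _); apply/seteqP; split => t /=.
  move=> [At Bt] l /=; rewrite !inE => /orP[]/eqP ->; rewrite /F ?eqxx//.
  by rewrite eq_sym (negbTE ij).
move=> h; split.
  by have := h i; rewrite /= mem_head /F eqxx; exact.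
by have := h j; rewrite /= !inE eqxx orbT /F eq_sym (negbTE ij); exact.
Qed.

Lemma triple_rect i j k (A B C : set S) : uniq [:: i; j; k] ->
  measurable A -> measurable B -> measurable C ->
  P (X i @^-1` A `&` (X j @^-1` B `&` X k @^-1` C)) = (mu A * (mu B * mu C))%E.
Proof.
move=> us mA mB mC; pose F l := if l == i then A else if l == j then B else C.
have mF l : measurable (F l) by rewrite /F; case: ifP => // _; case: ifP.
have [ij ik jk] : [/\ (j == i) = false, (k == i) = false & (k == j) = false].
  by move: us; rewrite /= !inE !negb_or ![_ == i]eq_sym [k == j]eq_sym =>
    /andP[/andP[/negbTE -> /negbTE ->]] /andP[/negbTE ->].
have Fi : F i = A by rewrite /F eqxx.
have Fj : F j = B by rewrite /F ij eqxx.
have Fk : F k = C by rewrite /F ik jk.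
have := iX us mF; rewrite !big_cons big_nil mule1 Fi Fj Fk !PX// => <-.
congr (P _); apply/seteqP; split => t /=.
  move=> [At [Bt Ct]] l /=; rewrite !inE => /or3P[]/eqP ->; rewrite ?Fi ?Fj ?Fk//.
move=> h; split; last split.
- by have := h i; rewrite /= !inE eqxx Fi; exact.
- by have := h j; rewrite /= !inE eqxx ?orbT Fj; exact.
- by have := h k; rewrite /= !inE eqxx ?orbT Fk; exact.
Qed.

Definition rv2 i j (t : T) : S * S := (X i t, X j t).
Definition rv3 i j k (t : T) : S * (S * S) := (X i t, (X j t, X k t)).

Lemma measurable_rv2 i j : measurable_fun setT (rv2 i j).
Proof. by apply: measurable_fun_pair; exact: measurable_funP. Qed.

Lemma measurable_rv3 i j k : measurable_fun setT (rv3 i j k).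
Proof.
apply: measurable_fun_pair; first exact: measurable_funP.
exact: measurable_rv2.
Qed.

HB.instance Definition _ (i j : nat) := isMeasurableFun.Build _ _ _ _ _ (measurable_rv2 i j).
HB.instance Definition _ (i j k : nat) := isMeasurableFun.Build _ _ _ _ _ (measurable_rv3 i j k).

Lemma pair_law i j (A : set (S * S)) : i != j -> measurable A ->
  distribution P (rv2 i j) A = (mu \x mu)%E A.
Proof.
move=> ij mA; apply: measure_prod_unique => //.
  by rewrite [X in (X < _)%E](_ : _ = 1%E) ?ltry//; exact: probability_setT.
move=> B C mB mC; rewrite [RHS]product_measure1E// -(pair_rect ij)//.
Qed.

(** The product rule on boxes A * (B * C) is first extended, for fixed A, from
    the rectangles B * C to all measurable sets of pairs. *)
Lemma triple_law i j k (A : set (S * (S * S))) : uniq [:: i; j; k] -> measurable A ->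
  distribution P (rv3 i j k) A = (mu \x (mu \x mu))%E A.
Proof.
move=> us mA.
pose q := (mu \x mu)%E : probability _ R.
pose m : {measure set (S * (S * S)) -> \bar R} := (mu \x q)%E.
change (distribution P (rv3 i j k) A = m A).
apply: measure_prod_unique => //.
  by rewrite [X in (X < _)%E](_ : _ = 1%E) ?ltry//; exact: probability_setT.
move=> B D mB mD; rewrite [RHS]product_measure1E//.
have [m1 m1E] : exists m1 : {measure set (S * S) -> \bar R},
    forall E, m1 E = P (rv2 j k @^-1` E `&` X i @^-1` B).
  unshelve eexists (pushforward (mrestr P (mXi i mB)) (rv2 j k)); last by [].
  exact: measurable_rv2.
have muB : mu B \is a fin_num by exact: fin_num_measure.
have b0 : 0 <= fine (mu B) by rewrite fine_ge0.
pose m2 : {measure set (S * S) -> \bar R} := mscale (NngNum b0) (mu \x mu)%E.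
have : m1 D = m2 D.
  apply: measure_prod_unique => //.
    by rewrite m1E preimage_setT setTI (le_lt_trans (probability_le1 _ _)) ?ltry//; exact: mXi.
  move=> A' C mA' mC; rewrite m1E /m2 /= /mscale /= product_measure1E// fineK//.
  by rewrite -(triple_rect us)// setIC.
by rewrite m1E /m2 /= /mscale /= fineK// => <-; rewrite setIC.
Qed.

End joint_law.

(** * A weak law of large numbers *)
Section markov.
Context d (T : measurableType d) {R : realType} (m : {measure set T -> \bar R}).

Lemma measurable_ge_set (f : T -> \bar R) (a : R) : measurable_fun setT f ->
  measurable [set t | (a%:E <= f t)%E].
Proof. by move=> mf; rewrite -[X in measurable X]setTI; exact: emeasurable_fun_c_infty. Qed.

Lemma markov_ge0 (f : T -> \bar R) (a : R) : measurable_fun setT f ->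
  (forall t, (0 <= f t)%E) -> 0 < a ->
  (m [set t | (a%:E <= f t)%E] <= a^-1%:E * \int[m]_t f t)%E.
Proof.
move=> mf f0 a0; set A := [set t | _].
have mA : measurable A by exact: measurable_ge_set.
rewrite -(@lee_pmul2l _ a%:E) ?lte_fin// muleA -EFinM divff ?gt_eqF// mul1e.
rewrite -integral_cst//; apply: (@le_trans _ _ (\int[m]_(t in A) f t)%E).
  apply: ge0_le_integral => //.
  - by move=> t _; rewrite lee_fin ltW.
  - exact: measurable_funTS.
by apply: ge0_subset_integral.
Qed.

Lemma integrable_bounded (f : T -> R) (M : R) : (m setT < +oo)%E ->
  measurable_fun setT f -> (forall t, `|f t| <= M) ->
  m.-integrable setT (EFin \o f).
Proof.
move=> moo mf fM; apply: measurable_bounded_integrable => //.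
exists M; split; rewrite ?num_real// => x Mx t _; apply: (le_trans (fM t)).
exact: ltW.
Qed.

End markov.

Section probability_integrals.
Context d (T : measurableType d) {R : realType} (P : probability T R).

Lemma probability_integrable (f : T -> R) (M : R) : measurable_fun setT f ->
  (forall t, `|f t| <= M) -> P.-integrable setT (EFin \o f).
Proof.
by apply: integrable_bounded; exact: (le_lt_trans (probability_le1 P measurableT) (ltry _)).
Qed.

Lemma probability_Rintegral_cst (c : R) : \int[P]_t c = c.
Proof.
rewrite Rintegral_cst//; transitivity (c * fine (P setT)); first by [].
by rewrite probability_setT mulr1.
Qed.

Lemma probability_integral_cst (c : R) : (\int[P]_t c%:E = c%:E)%E.
Proof.
rewrite integral_cst//; transitivity (c%:E * (P setT))%E; first by [].
by rewrite probability_setT mule1.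
Qed.

Lemma ler_norm_Rintegral_bound (f : T -> R) (M : R) : measurable_fun setT f ->
  (forall t, `|f t| <= M) -> `|\int[P]_t f t| <= M.
Proof.
move=> mf fM; apply: (le_trans (le_normr_Rintegral _ (probability_integrable mf fM))) => //.
rewrite -[leRHS]probability_Rintegral_cst; apply: le_Rintegral => //.
- by apply: (@probability_integrable _ M); [exact: measurableT_comp|move=> t; rewrite normr_id].
- by apply: (@probability_integrable _ `|M|).
Qed.

Lemma variance_le_second_moment (f : T -> R) (M : R) : measurable_fun setT f ->
  (forall t, `|f t| <= M) ->
  \int[P]_t (f t - \int[P]_s f s) ^+ 2 <= \int[P]_t (f t ^+ 2).
Proof.
move=> mf fM; set a := \int[P]_s f s.
have M0 : 0 <= M by rewrite (le_trans _ (fM point)).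
have iF := probability_integrable mf fM.
have i2 : P.-integrable setT (EFin \o (fun t => f t ^+ 2)).
  apply: (@probability_integrable _ (M ^+ 2)); first exact: measurable_funX.
  by move=> t; rewrite normrX lerXn2r ?nnegrE.
have -> : \int[P]_t (f t - a) ^+ 2 = \int[P]_t (f t ^+ 2 - (2 * a * f t - a ^+ 2)).
  by apply: eq_Rintegral => t _; ring.
have i1 : P.-integrable setT (EFin \o (fun t => 2 * a * f t)).
  by apply: (@probability_integrable _ (`|2 * a| * M));
    [exact: measurable_funM|move=> t; rewrite normrM ler_wpM2l].
have i0 : P.-integrable setT (EFin \o (fun t : T => a ^+ 2)).
  by apply: (@probability_integrable _ `|a ^+ 2|).
rewrite RintegralB//; last exact: (integrableB _ i1 i0).
rewrite RintegralB// RintegralZl// probability_Rintegral_cst -/a.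
rewrite gerBl (_ : _ - _ = a ^+ 2) ?sqr_ge0//; ring.
Qed.

End probability_integrals.

Section weak_law.
Context d (T : measurableType d) d' (S : measurableType d') {R : realType}
  (P : probability T R) (mu : probability S R) (X : nat -> {RV P >-> S}).
Hypotheses (iX : mutually_independent X) (dX : identically_distributed X mu).

Lemma ge0_integral_pair i j (f : S * S -> \bar R) : i != j ->
  measurable_fun setT f -> (forall u, (0 <= f u)%E) ->
  (\int[P]_t f (X i t, X j t) = \int[mu]_z \int[mu]_w f (z, w))%E.
Proof.
move=> ij mf f0; rewrite -(fubini_tonelli1 f)//.
rewrite -(@ge0_integral_distribution _ _ _ _ _ P (rv2 X i j))//.
apply: eq_measure_integral => A mA _; exact: pair_law.
Qed.

Lemma integral_triple i j k (f : S * (S * S) -> R) (M : R) : uniq [:: i; j; k] ->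
  measurable_fun setT f -> (forall u, `|f u| <= M) ->
  (\int[P]_t (f (X i t, (X j t, X k t)))%:E =
   \int[mu]_z \int[mu]_w \int[mu]_v (f (z, (w, v)))%:E)%E.
Proof.
move=> ij mf fM.
pose q := (mu \x mu)%E : probability _ R.
have mfE : measurable_fun setT (EFin \o f) by exact/measurable_EFinP.
transitivity (\int[mu]_z \int[q]_u (f (z, u))%:E)%E; last first.
  apply: eq_integral => z _.
  rewrite -(integral12_prod_meas1 (f := fun u => (f (z, u))%:E))//.
  apply: (@probability_integrable _ _ _ q (fun u => f (z, u)) M) => //.
  by apply: measurableT_comp => //; exact: measurable_pair1.
rewrite (@integral12_prod_meas1 _ _ _ _ _ mu q (EFin \o f)); last first.
  exact: (@probability_integrable _ _ _ ((mu \x q)%E : probability _ R) f M).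
transitivity (\int[distribution P (rv3 X i j k)]_u (EFin \o f) u)%E.
  rewrite integral_distribution//.
  apply: (@probability_integrable _ _ _ P (f \o rv3 X i j k) M).
    apply: measurableT_comp => //; exact: measurable_rv3.
  by move=> t; exact: fM.
apply: eq_measure_integral => A mA _; exact: triple_law.
Qed.

Variables (g : S * S -> R) (M : R).
Hypotheses (mg : measurable_fun setT g) (gM : forall u, `|g u| <= M).

(** The conditional expectation of g(X_i, X_j) given X_i = z, for i <> j. *)
Definition cond_mean (z : S) : R := \int[mu]_w g (z, w).

Lemma measurable_section z : measurable_fun setT (fun w => g (z, w)).
Proof. by apply: measurableT_comp => //; exact: measurable_pair1. Qed.

Lemma measurable_cond_mean : measurable_fun setT cond_mean.
Proof.
apply: (measurableT_comp (@fine_measurable R setT _)) => //.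
apply: (measurable_fubini_F (m1 := mu) (m2 := mu) (f := EFin \o g)).
exact: (@probability_integrable _ _ _ ((mu \x mu)%E : probability _ R) g M).
Qed.

Let h (u : S * S) := g u - cond_mean u.1.

Let mh : measurable_fun setT h.
Proof.
apply: measurable_funB => //; apply: measurableT_comp => //.
exact: measurable_cond_mean.
Qed.

Let hM u : `|h u| <= M + M.
Proof.
rewrite (le_trans (ler_normB _ _))// lerD//.
by apply: ler_norm_Rintegral_bound => //; exact: measurable_section.
Qed.

Let M0 : 0 <= M. Proof. by rewrite (le_trans _ (gM point)). Qed.

Let int_h z : (\int[mu]_w (h (z, w))%:E = 0)%E.
Proof.
rewrite /h /=; under eq_integral do rewrite EFinB.
have ig := probability_integrable mu (measurable_section z) (fun w => gM (z, w)).
rewrite integralB_EFin//; last by apply: (@probability_integrable _ _ _ _ _ `|cond_mean z|).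
rewrite probability_integral_cst.
rewrite /cond_mean /Rintegral fineK; last exact: integrable_fin_num.
by rewrite subee//; exact: integrable_fin_num.
Qed.

Let mhh : measurable_fun setT (fun u : S * (S * S) => h (u.1, u.2.1) * h (u.1, u.2.2)).
Proof.
apply: measurable_funM; apply: (measurableT_comp mh); apply: measurable_fun_pair => //.
  exact: (measurableT_comp (@measurable_fst _ _ S S) (@measurable_snd _ _ S (S * S)%type)).
exact: (measurableT_comp (@measurable_snd _ _ S S) (@measurable_snd _ _ S (S * S)%type)).
Qed.

Let hhM u v : `|h u * h v| <= (M + M) * (M + M).
Proof. by rewrite normrM ler_pM. Qed.

(** Given the first variable, the two factors are centered and independent. *)
Lemma cross_moment i j k : uniq [:: i; j; k] ->
  (\int[P]_t (h (X i t, X j t) * h (X i t, X k t))%:E = 0)%E.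
Proof.
move=> us; rewrite (integral_triple us mhh (M := (M + M) * (M + M)))//=.
apply: integral0_eq => z _; apply: integral0_eq => w _.
under eq_integral do rewrite EFinM.
rewrite integralZl//; first by rewrite int_h mule0.
apply: (@probability_integrable _ _ _ _ (fun v => h (z, v)) (M + M)) => //.
by apply: measurableT_comp => //; exact: measurable_pair1.
Qed.

Lemma second_moment i j : i != j ->
  (\int[P]_t (h (X i t, X j t) ^+ 2)%:E <=
   \int[mu]_z \int[mu]_w (g (z, w) ^+ 2)%:E)%E.
Proof.
move=> ij.
have m2 : measurable_fun setT (fun u => (h u ^+ 2)%:E).
  by apply/measurable_EFinP; exact: measurable_funX.
have m2' : measurable_fun setT (fun u => (g u ^+ 2)%:E).
  by apply/measurable_EFinP; exact: measurable_funX.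
rewrite (@ge0_integral_pair i j (fun u => (h u ^+ 2)%:E))//; last first.
  by move=> u; rewrite lee_fin sqr_ge0.
apply: ge0_le_integral => //.
- by move=> z _; apply: integral_ge0 => w _; rewrite lee_fin sqr_ge0.
- apply: (@measurable_fun_fubini_tonelli_F _ _ _ _ _ mu (fun u => (h u ^+ 2)%:E)) => // u.
  by rewrite lee_fin sqr_ge0.
- apply: (@measurable_fun_fubini_tonelli_F _ _ _ _ _ mu (fun u => (g u ^+ 2)%:E)) => // u.
  by rewrite lee_fin sqr_ge0.
move=> z _.
have mz := measurable_section z.
have mhz : measurable_fun setT (fun w => h (z, w)).
  by apply: measurableT_comp => //; exact: measurable_pair1.
have sq (f : S -> R) (N : R) : measurable_fun setT f -> (forall w, `|f w| <= N) ->
    mu.-integrable setT (EFin \o (fun w => f w ^+ 2)).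
  move=> mf fN; apply: (@probability_integrable _ _ _ _ _ (N ^+ 2)).
    exact: measurable_funX.
  move=> w; rewrite normrX lerXn2r ?nnegrE// (le_trans _ (fN w))//.
have := @variance_le_second_moment _ _ _ mu _ _ mz (fun w => gM (z, w)).
rewrite /Rintegral -lee_fin !fineK//.
- exact: (integrable_fin_num _ (sq _ _ mz (fun w => gM (z, w)))).
- exact: (integrable_fin_num _ (sq _ _ mhz (fun w => hM (z, w)))).
Qed.

Variables (n : nat) (j : 'I_n).

Definition deviation (t : T) : R :=
  \sum_(k < n | k != j) (g (X j t, X k t) - cond_mean (X j t)).

Lemma measurable_pairX (f : S * S -> R) (k : 'I_n) : measurable_fun setT f ->
  measurable_fun setT (fun t => f (X j t, X k t)).
Proof. by move=> mf; apply: measurableT_comp => //; exact: (measurable_rv2 X j k). Qed.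

Lemma measurable_deviation : measurable_fun setT deviation.
Proof.
have -> : deviation = fun t => \sum_(k <- [seq k <- enum 'I_n | k != j]) h (X j t, X k t).
  by apply/funext => t; rewrite big_filter big_enum_cond.
by apply: measurable_sum => k; exact: measurable_pairX.
Qed.

(** In the expansion of the square only the diagonal terms survive. *)
Lemma deviation_second_moment :
  (\int[P]_t (deviation t ^+ 2)%:E <=
   n.-1%:R%:E * \int[mu]_z \int[mu]_w (g (z, w) ^+ 2)%:E)%E.
Proof.
have ihh (k l : 'I_n) : P.-integrable setT
    (fun t => (h (X j t, X k t) * h (X j t, X l t))%:E).
  apply: (@probability_integrable _ _ _ _ (fun t => h (X j t, X k t) * h (X j t, X l t))
    ((M + M) * (M + M))) => //.
  by apply: measurable_funM; exact: measurable_pairX.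
have -> : (\int[P]_t (deviation t ^+ 2)%:E = \sum_(k < n | k != j)
    \sum_(l < n | l != j) \int[P]_t (h (X j t, X k t) * h (X j t, X l t))%:E)%E.
  under [RHS]eq_bigr do rewrite -integral_sum//.
  rewrite -integral_sum//; last by move=> k; apply: integrable_sum.
  apply: eq_integral => t _; rewrite expr2 /deviation big_distrlr/= -sumEFin.
  by apply: eq_bigr => k _; rewrite -sumEFin.
set q := (\int[mu]_z _)%E.
apply: (@le_trans _ _ (\sum_(k < n | k != j) q)%E).
  apply: lee_sum => k kj; rewrite (bigD1 k)//= big1 ?adde0.
    by under eq_integral do rewrite -expr2; apply: second_moment; rewrite eq_sym.
  move=> l /andP[lj lk]; apply: cross_moment.
  rewrite /= !inE !negb_or -![_ == _ :> nat]/(_ == _) ![nat_of_ord j == _]eq_sym.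
  by rewrite kj lj/= eq_sym lk.
rewrite big_const cardC1 card_ord.
elim: n.-1 => [|m IH]; first by rewrite mul0e.
rewrite iterS -natr1 EFinD ge0_muleDl ?lee_fin// mul1e addeC leeD//.
Qed.

Lemma weak_law (lam : R) : (1 < n)%N -> 0 < lam ->
  (P [set t | (lam * n.-1%:R <= `|deviation t|)%R] <=
   (lam ^+ 2 * n.-1%:R)^-1%:E * \int[mu]_z \int[mu]_w (g (z, w) ^+ 2)%:E)%E.
Proof.
move=> n1 lam0; have m0 : 0 < n.-1%:R :> R by rewrite ltr0n -subn1 subn_gt0.
have -> : [set t | (lam * n.-1%:R <= `|deviation t|)%R] =
    [set t | (((lam * n.-1%:R) ^+ 2)%:E <= (deviation t ^+ 2)%:E)%E].
  apply/seteqP; split => t /=; rewrite lee_fin -[deviation t ^+ 2]real_normK ?num_real//;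
    by rewrite ler_pXn2r// nnegrE ?mulr_ge0// ltW.
have md : measurable_fun setT (fun t => (deviation t ^+ 2)%:E).
  by apply/measurable_EFinP; apply: measurable_funX; exact: measurable_deviation.
apply: (le_trans (markov_ge0 _ md _ _)).
- by move=> t; rewrite lee_fin sqr_ge0.
- by rewrite exprn_gt0// mulr_gt0.
apply: (@le_trans _ _ (((lam * n.-1%:R) ^+ 2)^-1%:E *
   (n.-1%:R%:E * \int[mu]_z \int[mu]_w (g (z, w) ^+ 2)%:E))%E).
  by rewrite lee_wpmul2l ?deviation_second_moment// lee_fin invr_ge0 sqr_ge0.
rewrite muleA -EFinM (_ : _ * _ = (lam ^+ 2 * n.-1%:R)^-1)//.
by field; rewrite !gt_eqF.
Qed.

End weak_law.

(** * Truncation of the Cauchy kernel *)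
Section kernels.
Context {R : realType}.
Implicit Types (M : R) (u : R[i] * R[i]).

(** The value is +oo on the diagonal, so that coinciding points count among the
    near pairs below. *)
Definition riesz u : \bar R := ((normc (u.1 - u.2))%:E^-1)%E.
Definition far M u : bool := 1 <= M * normc (u.1 - u.2).
Definition near_riesz M u : \bar R := if far M u then 0%E else riesz u.
Definition far_re M u : R := if far M u then complex.Re ((u.1 - u.2)^-1) else 0.
Definition far_im M u : R := if far M u then complex.Im ((u.1 - u.2)^-1) else 0.
Definition far_sq M u : R := if far M u then (normc (u.1 - u.2) ^+ 2)^-1 else 0.

Lemma riesz_ge0 u : (0 <= riesz u)%E.
Proof. by rewrite /riesz inve_ge0 lee_fin normc_ge0. Qed.

Lemma near_riesz_ge0 M u : (0 <= near_riesz M u)%E.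
Proof. by rewrite /near_riesz; case: ifP => // _; exact: riesz_ge0. Qed.

Lemma near_riesz_le M u : (near_riesz M u <= riesz u)%E.
Proof. by rewrite /near_riesz; case: ifP => // _; exact: riesz_ge0. Qed.

Lemma measurable_normc_diff : measurable_fun setT (fun u : R[i] * R[i] => normc (u.1 - u.2)).
Proof. by apply: measurable_normcB. Qed.

Lemma measurable_riesz : measurable_fun setT riesz.
Proof.
rewrite /riesz; under eq_fun do rewrite inver.
apply: measurable_fun_ifT => //.
- by apply: measurable_fun_eqr => //; exact: measurable_normc_diff.
- by apply/measurable_EFinP; apply: measurable_normcBV.
Qed.

Lemma measurable_far M : measurable_fun setT (far M).
Proof.
apply: measurable_fun_ler => //; apply: measurable_funM => //.
exact: measurable_normc_diff.
Qed.

Lemma measurable_near_riesz M : measurable_fun setT (near_riesz M).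
Proof.
by apply: measurable_fun_ifT => //; [exact: measurable_far|exact: measurable_riesz].
Qed.

Lemma measurable_far_re M : measurable_fun setT (far_re M).
Proof.
by apply: measurable_fun_ifT => //; [exact: measurable_far|exact: measurable_ReBV].
Qed.

Lemma measurable_far_im M : measurable_fun setT (far_im M).
Proof.
by apply: measurable_fun_ifT => //; [exact: measurable_far|exact: measurable_ImBV].
Qed.

Lemma measurable_far_sq M : measurable_fun setT (far_sq M).
Proof.
apply: measurable_fun_ifT => //; first exact: measurable_far.
under eq_fun do rewrite -exprVn.
by apply: measurable_funX; exact: measurable_normcBV.
Qed.

Lemma far_gt0 M u : 0 < M -> far M u -> 0 < normc (u.1 - u.2).
Proof. by move=> M0; rewrite /far => h; rewrite -(pmulr_rgt0 _ M0) (lt_le_trans _ h). Qed.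

Lemma far_inv_le M u : 0 < M -> far M u -> (normc (u.1 - u.2))^-1 <= M.
Proof.
move=> M0 fu; have := far_gt0 M0 fu; move: fu; rewrite /far => h d0.
by rewrite invf_ple ?posrE// -[leLHS]mulr1 ler_pdivrMl.
Qed.

Lemma far_re_bounded M u : 0 < M -> `|far_re M u| <= M.
Proof.
move=> M0; rewrite /far_re; case: ifP => [fu|]; last by rewrite normr0 ltW.
by rewrite (le_trans (normr_Re_le _))// normcV far_inv_le.
Qed.

Lemma far_im_bounded M u : 0 < M -> `|far_im M u| <= M.
Proof.
move=> M0; rewrite /far_im; case: ifP => [fu|]; last by rewrite normr0 ltW.
by rewrite (le_trans (normr_Im_le _))// normcV far_inv_le.
Qed.

Lemma far_sq_ge0 M u : 0 <= far_sq M u.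
Proof. by rewrite /far_sq; case: ifP => // _; rewrite invr_ge0 sqr_ge0. Qed.

(** Truncation makes the square of the kernel integrable: one of its two factors
    is at most M. *)
Lemma far_sq_le M u : 0 < M -> ((far_sq M u)%:E <= M%:E * riesz u)%E.
Proof.
move=> M0; rewrite /far_sq /riesz; case: ifP => [fu|_]; last first.
  by rewrite mule_ge0 ?riesz_ge0// lee_fin ltW.
have d0 := far_gt0 M0 fu.
rewrite inver gt_eqF// -EFinM lee_fin expr2 invfM ler_wpM2r ?invr_ge0 ?normc_ge0//.
exact: far_inv_le.
Qed.

Lemma far_re_sq M u : far_re M u ^+ 2 <= far_sq M u.
Proof.
rewrite /far_re /far_sq; case: ifP => // _; last by rewrite expr0n.
rewrite -real_normK ?num_real// -exprVn -normcV.
by rewrite lerXn2r ?nnegrE ?normc_ge0// normr_Re_le.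
Qed.

Lemma far_im_sq M u : far_im M u ^+ 2 <= far_sq M u.
Proof.
rewrite /far_im /far_sq; case: ifP => // _; last by rewrite expr0n.
rewrite -real_normK ?num_real// -exprVn -normcV.
by rewrite lerXn2r ?nnegrE ?normc_ge0// normr_Im_le.
Qed.

End kernels.

Lemma ereal_cvg0_le {R : realType} (u : (\bar R)^nat) (e : R) :
  u n @[n --> \oo] --> 0%E -> 0 < e ->
  exists N, forall n, (N <= n)%N -> (u n <= e%:E)%E.
Proof.
move=> /fine_cvgP[[N1 _ fu] /cvgrPdist_le cu] e0.
have [N2 _ h] := cu e e0.
exists (maxn N1 N2) => n; rewrite geq_max => /andP[n1 n2].
rewrite -(fineK (fu _ n1)) lee_fin.
by have := h _ n2; rewrite /= sub0r normrN; apply: le_trans; exact: ler_norm.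
Qed.

Section energy.
Context {R : realType} (mu : probability R[i] R).
Hypothesis energy_fin : (energy1 mu < +oo)%E.
Implicit Types (M e : R).

Let pr : probability _ R := (mu \x mu)%E.

Lemma energy1E : energy1 mu = (\int[pr]_u riesz u)%E.
Proof.
rewrite (fubini_tonelli1 (@riesz R))//; first exact: measurable_riesz.
by move=> u; exact: riesz_ge0.
Qed.

Lemma integrable_riesz : pr.-integrable setT (@riesz R).
Proof.
apply/integrableP; split; first exact: measurable_riesz.
by under eq_integral do rewrite gee0_abs ?riesz_ge0//; rewrite -energy1E.
Qed.

Definition near_energy M : \bar R := (\int[mu]_z \int[mu]_w near_riesz M (z, w))%E.

Lemma near_energyE M : near_energy M = (\int[pr]_u near_riesz M u)%E.
Proof.
rewrite (fubini_tonelli1 (near_riesz M))//; first exact: measurable_near_riesz.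
by move=> u; exact: near_riesz_ge0.
Qed.

Lemma near_energy_anti M M' : M <= M' -> (near_energy M' <= near_energy M)%E.
Proof.
move=> MM'; rewrite !near_energyE; apply: ge0_le_integral => //.
- by move=> u _; exact: near_riesz_ge0.
- exact: measurable_near_riesz.
- exact: measurable_near_riesz.
move=> u _; rewrite /near_riesz.
case: ifP => [_|nf]; first by case: ifP => // _; exact: riesz_ge0.
case: ifP => [f|//]; move: nf; rewrite /far (le_trans f)//.
by rewrite ler_wpM2r// normc_ge0.
Qed.

(** The diagonal is negligible because 1/|z - w| is infinite there and has a
    finite integral; off it the near part of the kernel vanishes once M is
    large. *)
Lemma near_energy_small e : 0 < e ->
  exists2 M, 0 < M & forall M', M <= M' -> (near_energy M' <= e%:E)%E.
Proof.
move=> e0.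
have cv : {ae pr, forall u, setT u -> near_riesz k.+1%:R u @[k --> \oo] --> (0 : \bar R)%E}.
  have := integrable_ae measurableT integrable_riesz.
  apply: filterS => u /(_ I) + _; rewrite /riesz inver; case: eqP => [//|/eqP d0 _].
  apply: cvg_near_cst; exists (Num.truncn (normc (u.1 - u.2))^-1) => // k /= hk.
  rewrite /near_riesz /far ifT//.
  have d1 : 0 < normc (u.1 - u.2) by rewrite lt_def d0 normc_ge0.
  rewrite -ler_pdivrMr// mul1r (le_trans (ltW (truncnS_gt _)))//.
  by rewrite ler_nat ltnS.
have dom : {ae pr, forall u k, setT u -> (`|near_riesz k.+1%:R u| <= riesz u)%E}.
  by apply: aeW => u k _; rewrite gee0_abs ?near_riesz_ge0// near_riesz_le.
have [_ _] := @dominated_convergence _ _ _ pr setT measurableT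
  (fun k => near_riesz k.+1%:R) (cst 0%E) (@riesz R)
  (fun k => measurable_near_riesz k.+1%:R) (measurable_cst _) cv integrable_riesz dom.
rewrite integral0 => /ereal_cvg0_le /(_ e0)[N hN].
exists N.+1%:R => // M' NM'; apply: (le_trans (near_energy_anti NM')).
by rewrite near_energyE; exact: hN.
Qed.

Definition near_potential M z : \bar R := (\int[mu]_w near_riesz M (z, w))%E.

Lemma near_potential_ge0 M z : (0 <= near_potential M z)%E.
Proof. by apply: integral_ge0 => w _; exact: near_riesz_ge0. Qed.

Lemma measurable_near_potential M : measurable_fun setT (near_potential M).
Proof.
apply: (@measurable_fun_fubini_tonelli_F _ _ _ _ _ mu (near_riesz M)).
  exact: measurable_near_riesz.
by move=> u; exact: near_riesz_ge0.
Qed.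

Lemma measurable_riesz_section M z : measurable_fun setT (fun w => near_riesz M (z, w)).
Proof. by apply: measurableT_comp; [exact: measurable_near_riesz|exact: measurable_pair1]. Qed.

(** Truncation changes the real or imaginary part F of the Cauchy kernel by at
    most the part of 1/|z - w| that it removes. *)
Lemma truncation_error (F : R[i] -> R) M (z : R[i]) (c : R) : 0 < M ->
  (forall x, `|F x| <= normc x) ->
  measurable_fun setT (fun w : R[i] => F ((z - w)^-1)) ->
  (near_potential M z <= c%:E)%E ->
  `|\int[mu]_w F ((z - w)^-1) -
    \int[mu]_w (if far M (z, w) then F ((z - w)^-1) else 0)| <= c.
Proof.
move=> M0 Fle mF npc.
have npfin : (near_potential M z < +oo)%E by rewrite (le_lt_trans npc)// ltry.
have mfar : measurable_fun setT (fun w => far M (z, w)).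
  by apply: measurableT_comp; [exact: measurable_far|exact: measurable_pair1].
pose Ff w := if far M (z, w) then F ((z - w)^-1) else 0.
pose Fn w := if far M (z, w) then 0 else F ((z - w)^-1).
have mFf : measurable_fun setT Ff by exact: measurable_fun_ifT.
have mFn : measurable_fun setT Fn by exact: measurable_fun_ifT.
have iFf : mu.-integrable setT (EFin \o Ff).
  apply: (@probability_integrable _ _ _ _ _ M) => // w; rewrite /Ff.
  case: ifP => [fw|]; last by rewrite normr0 ltW.
  by rewrite (le_trans (Fle _))// normcV (far_inv_le M0 fw).
have Fnle w : (`|(Fn w)%:E| <= near_riesz M (z, w))%E.
  rewrite /Fn /near_riesz; case: ifP => _; first by rewrite abse0.
  rewrite /riesz inver /=; case: eqP => [|_]; first by rewrite leey.
  by rewrite lee_fin -normcV Fle.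
have iFn : mu.-integrable setT (EFin \o Fn).
  apply/integrableP; split; first exact/measurable_EFinP.
  apply: le_lt_trans npfin; apply: ge0_le_integral => //.
  - by apply: measurableT_comp => //; exact/measurable_EFinP.
  - exact: measurable_riesz_section.
  - by move=> w _; exact: Fnle.
have -> : \int[mu]_w F ((z - w)^-1) = \int[mu]_w Ff w + \int[mu]_w Fn w.
  rewrite -RintegralD//; apply: eq_Rintegral => w _; rewrite /Ff /Fn.
  by case: ifP; rewrite ?addr0 ?add0r.
rewrite addrAC subrr add0r -lee_fin EFin_normr_Rintegral//.
apply: (le_trans (le_abse_integral mu measurableT _)); first exact/measurable_EFinP.
apply: le_trans npc; apply: ge0_le_integral => //.
- by apply: measurableT_comp => //; exact/measurable_EFinP.
- exact: measurable_riesz_section.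
Qed.

Lemma potential_truncation M z (c : R) : 0 < M -> (near_potential M z <= c%:E)%E ->
  `|complex.Re (potential mu z) - cond_mean mu (far_re M) z| <= c /\
  `|complex.Im (potential mu z) - cond_mean mu (far_im M) z| <= c.
Proof.
move=> M0 npc; split.
  apply: (@truncation_error (@complex.Re R)) => //.
  - exact: normr_Re_le.
  - by apply: measurable_ReBV => //.
apply: (@truncation_error (@complex.Im R)) => //.
- exact: normr_Im_le.
- by apply: measurable_ImBV => //.
Qed.

Lemma measurable_potential_part (F : R[i] -> R) :
  (forall x, `|F x| <= normc x) ->
  measurable_fun setT (fun u : R[i] * R[i] => F ((u.1 - u.2)^-1)) ->
  measurable_fun setT (fun z : R[i] => \int[mu]_w F ((z - w)^-1)).
Proof.
move=> Fle mF.
apply: (measurableT_comp (@fine_measurable R setT _)) => //.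
apply: (@measurable_fubini_F _ _ _ _ _ mu mu (fun u : R[i] * R[i] => (F ((u.1 - u.2)^-1))%:E)).
apply: (le_integrable measurableT _ _ integrable_riesz).
  exact/measurable_EFinP.
move=> u _; rewrite [leRHS]gee0_abs ?riesz_ge0// /riesz inver /=.
case: eqP => [|_]; first by rewrite leey.
by rewrite lee_fin -normcV Fle.
Qed.

Lemma measurable_normc_potential : measurable_fun setT (fun z => normc (potential mu z)).
Proof.
apply: (measurableT_comp measurable_sqrtr); apply: measurable_funD; apply: measurable_funX.
- apply: measurable_potential_part; first exact: normr_Re_le.
  exact: measurable_ReBV.
- apply: measurable_potential_part; first exact: normr_Im_le.
  exact: measurable_ImBV.
Qed.

Hypothesis V0 : mu [set z | potential mu z = 0] = 0%E.

(** The sets where |V| < 1/(k+1) decrease to the zero set of V. *)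
Lemma small_potential_rare e : 0 < e ->
  exists2 c, 0 < c & (mu [set z | (normc (potential mu z) < c)%R] <= e%:E)%E.
Proof.
move=> e0.
pose A k : set R[i] := [set z | normc (potential mu z) < k.+1%:R^-1].
have mA k : measurable (A k).
  rewrite -[X in measurable X]setTI.
  exact: (measurable_fun_ltr measurable_normc_potential (measurable_cst _)).
have capA : \bigcap_k A k = [set z | potential mu z = 0].
  apply/seteqP; split => z /=; last first.
    move=> z0 k _; suff : normc (potential mu z) < k.+1%:R^-1 by [].
    by rewrite z0 normc0 invr_gt0.
  move=> h; apply/eqP; rewrite -normc_eq0 eq_le normc_ge0 andbT leNgt; apply/negP => v0.
  have := h (Num.truncn (normc (potential mu z))^-1) I; rewrite /A /= ltNge => /negP; apply.
  by rewrite invf_ple ?posrE// ltW// truncnS_gt.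
have capA0 : mu (\bigcap_k A k) = 0%E by rewrite capA; exact: V0.
have /ereal_cvg0_le /(_ e0)[N hN] : mu (A n) @[n --> \oo] --> 0%E.
  rewrite -capA0; apply: (@nonincreasing_cvg_mu _ _ _ mu A) => //.
  - by rewrite (le_lt_trans (probability_le1 _ _)) ?ltry.
  - exact: bigcap_measurableType.
  - move=> i j ij; apply/subsetPset => z; rewrite /A /= => hz; apply: (lt_le_trans hz).
    by rewrite lef_pV2 ?posrE// ler_nat.
by exists N.+1%:R^-1; [rewrite invr_gt0|exact: hN].
Qed.

End energy.

(** * Most sample points are good *)
Section rare_events.
Context d (T : measurableType d) {R : realType} (P : probability T R).

(** Measurability is part of the notion because the value of P on other sets
    carries no information. *)
Definition rare (a : R) (A : set T) := measurable A /\ (P A <= a%:E)%E.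

Lemma rareU a b A B : rare a A -> rare b B -> rare (a + b) (A `|` B).
Proof.
move=> [mA PA] [mB PB]; split; first exact: measurableU.
by rewrite (le_trans (measureU2 _ mA mB))// EFinD leeD.
Qed.

End rare_events.

Section pair_sums.
Context d (T : measurableType d) d' (S : measurableType d') {R : realType}
  (P : probability T R) (mu : probability S R) (X : nat -> {RV P >-> S}).
Hypotheses (iX : mutually_independent X) (dX : identically_distributed X mu).
Variables (n : nat) (j : 'I_n).

Let big_others (f : 'I_n -> \bar R) : (\sum_(k < n | k != j) f k =
  \sum_(k <- [seq k <- enum 'I_n | k != j]) f k)%E.
Proof. by rewrite big_filter big_enum_cond. Qed.

Lemma measurable_pair_sum (f : S * S -> \bar R) : measurable_fun setT f ->
  measurable_fun setT (fun t => \sum_(k < n | k != j) f (X j t, X k t))%E.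
Proof.
move=> mf; under eq_fun do rewrite big_others.
apply: emeasurable_sum => k.
by apply: measurableT_comp => //; exact: (measurable_rv2 X j k).
Qed.

(** Each of the n.-1 pairs has law mu x mu. *)
Lemma pair_sum_markov (f : S * S -> \bar R) (a q : R) : measurable_fun setT f ->
  (forall u, (0 <= f u)%E) -> 0 < a ->
  (\int[mu]_z \int[mu]_w f (z, w) <= q%:E)%E ->
  rare P (a^-1 * (n.-1%:R * q))
    [set t | (a%:E <= \sum_(k < n | k != j) f (X j t, X k t))%E].
Proof.
move=> mf f0 a0 fq; have ms := measurable_pair_sum mf.
split; first exact: measurable_ge_set.
apply: (le_trans (markov_ge0 _ ms _ a0)) => [t|]; first by apply: sume_ge0 => k _.
rewrite EFinM lee_wpmul2l ?lee_fin ?invr_ge0 ?(ltW a0)//.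
under eq_integral do rewrite big_others.
rewrite ge0_integral_sum//; last first.
  by move=> k; apply: measurableT_comp => //; exact: (measurable_rv2 X j k).
rewrite -big_others.
apply: (@le_trans _ _ (\sum_(k < n | k != j) q%:E)%E); last first.
  by rewrite sumEFin lee_fin sumr_const cardC1 card_ord mulr_natl.
apply: lee_sum => k kj; rewrite (ge0_integral_pair iX dX (f := f))//.
by rewrite eq_sym.
Qed.

Lemma single_rare (A : set S) (q : R) : measurable A -> (mu A <= q%:E)%E ->
  rare P q (X j @^-1` A).
Proof.
move=> mA hA; split; last by have := dX j mA; rewrite /distribution /pushforward => ->.
by rewrite -[X in measurable X]setTI; apply: measurable_funP.
Qed.

Lemma weak_law_rare (g : S * S -> R) (M lam q : R) : (1 < n)%N -> 0 < lam ->
  measurable_fun setT g -> (forall u, `|g u| <= M) ->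
  (\int[mu]_z \int[mu]_w (g (z, w) ^+ 2)%:E <= q%:E)%E ->
  rare P ((lam ^+ 2 * n.-1%:R)^-1 * q)
    [set t | lam * n.-1%:R <= `|deviation mu X g j t|].
Proof.
move=> n1 lam0 mg gM hq; split.
  rewrite -[X in measurable X]setTI.
  apply: (measurable_fun_ler (measurable_cst _)) => //.
  by apply: measurableT_comp => //; exact: (measurable_deviation mu X mg gM j).
apply: (le_trans (weak_law iX dX mg gM j n1 lam0)).
by rewrite EFinM lee_wpmul2l// lee_fin invr_ge0 mulr_ge0// sqr_ge0.
Qed.

End pair_sums.

Section bad_indices.
Context {R : realType} (mu : probability R[i] R).
Hypothesis energy_fin : (energy1 mu < +oo)%E.
Hypothesis V0 : mu [set z | potential mu z = 0] = 0%E.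
Context d (T : measurableType d) (P : probability T R) (X : nat -> {RV P >-> R[i]}).
Hypotheses (iX : mutually_independent X) (dX : identically_distributed X mu).

Let E : R := fine (energy1 mu).

Let energy_ge0 : (0 <= energy1 mu)%E.
Proof.
apply: integral_ge0 => z _; apply: integral_ge0 => w _.
exact: (riesz_ge0 (z, w)).
Qed.

Let EE : energy1 mu = E%:E.
Proof. by rewrite /E fineK// ge0_fin_numE. Qed.

Let E0 : 0 <= E. Proof. exact: fine_ge0. Qed.

Lemma far_sq_integral (M : R) (f : R[i] * R[i] -> R) : 0 < M ->
  measurable_fun setT f -> (forall u, 0 <= f u <= far_sq M u) ->
  (\int[mu]_z \int[mu]_w (f (z, w))%:E <= (M * E)%:E)%E.
Proof.
move=> M0 mf hf; rewrite EFinM -EE.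
have mfE : measurable_fun setT (fun u => (f u)%:E) by exact/measurable_EFinP.
have f0 u : (0 <= (f u)%:E)%E by rewrite lee_fin; case/andP: (hf u).
rewrite (energy1E) -(fubini_tonelli1 (fun u => (f u)%:E))//.
rewrite -ge0_integralZl//; last 3 first.
- exact: measurable_riesz.
- by move=> u _; exact: riesz_ge0.
- by rewrite lee_fin ltW.
apply: ge0_le_integral => //.
- by apply: emeasurable_funM => //; exact: measurable_riesz.
- move=> u _; apply: le_trans (far_sq_le u M0); rewrite lee_fin.
  by case/andP: (hf u).
Qed.

Section fixed_index.
Variables (n : nat) (j : 'I_n) (c M : R).
Hypotheses (n1 : (1 < n)%N) (c0 : 0 < c) (M0 : 0 < M).
Let m : R := n.-1%:R.
Let m0 : 0 < m. Proof. by rewrite ltr0n -subn1 subn_gt0. Qed.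

(** Some other point is within 1/M of X_j: its term alone exceeds M. *)
Definition clustered : set T :=
  [set t | (M%:E <= \sum_(k < n | k != j) near_riesz M (X j t, X k t))%E].
Definition large_squares : set T :=
  [set t | (((c * m) ^+ 2 / 32)%:E <= \sum_(k < n | k != j) (far_sq M (X j t, X k t))%:E)%E].
Definition re_deviates : set T := [set t | c * m <= `|deviation mu X (far_re M) j t|].
Definition im_deviates : set T := [set t | c * m <= `|deviation mu X (far_im M) j t|].
Definition small_potential : set T := X j @^-1` [set z | normc (potential mu z) < 5 * c].
Definition large_near_potential : set T := X j @^-1` [set z | (c%:E <= near_potential mu M z)%E].

Definition bad_event := clustered `|` large_squares `|`
  (re_deviates `|` im_deviates) `|` (small_potential `|` large_near_potential).

(** Outside the bad event all pairs are far, so the Cauchy sum is the truncated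
    one. Each of its two parts is within c * m of m times its conditional mean,
    which is within c of the corresponding part of V(X_j); as |V(X_j)| is at
    least 5 * c, the modulus of the sum is at least (5 - 2 - 2) * c * m. *)
Lemma bad_event_good t : ~ bad_event t -> good (X ^~ t) (c * m) j.
Proof.
move=> nb.
have nnear : ~ clustered t by move=> h; apply: nb; left; left; left.
have nsq : ~ large_squares t by move=> h; apply: nb; left; left; right.
have nre : ~ re_deviates t by move=> h; apply: nb; left; right; left.
have nim : ~ im_deviates t by move=> h; apply: nb; left; right; right.
have npot : ~ small_potential t by move=> h; apply: nb; right; left.
have nnp : ~ large_near_potential t by move=> h; apply: nb; right; right.
have farP k : k != j -> far M (X j t, X k t).
  move=> kj; apply/negPn/negP => nf; apply: nnear; rewrite /clustered /=.
  rewrite (bigD1 k)//= -[leLHS]adde0 leeD//; last first.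
    by apply: sume_ge0 => l _; exact: near_riesz_ge0.
  rewrite /near_riesz (negbTE nf) /riesz inver; case: eqP => [_|/eqP d0]; first by rewrite leey.
  have d1 : 0 < normc (X j t - X k t) by rewrite lt_def d0 normc_ge0.
  rewrite lee_fin /= -[leRHS]mul1r ler_pdivlMr//.
  by move: nf; rewrite /far -ltNge /= => /ltW.
split.
- move=> k kj jk; have := far_gt0 M0 (farP k kj).
  by rewrite /= jk subrr normc0 ltxx.
- have -> : cauchy_sum (X ^~ t) j =
      (\sum_(k < n | k != j) far_re M (X j t, X k t)) +i*
      (\sum_(k < n | k != j) far_im M (X j t, X k t)).
    rewrite /cauchy_sum.
    rewrite (eq_bigr (fun k : 'I_n =>
        far_re M (X j t, X k t) +i* far_im M (X j t, X k t))); last first.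
      by move=> k kj; rewrite /far_re /far_im farP//; case: ((X j t - X k t)^-1).
    by elim/big_ind3 : _ => // a1 a2 a3 b1 b2 b3 -> ->.
  have np : (near_potential mu M (X j t) <= c%:E)%E.
    by rewrite leNgt; apply/negP => h; apply: nnp; exact: ltW.
  have [hre him] := potential_truncation M0 np.
  set a := cond_mean mu (far_re M) (X j t) in hre.
  set b := cond_mean mu (far_im M) (X j t) in him.
  have V5 : 5 * c <= normc (potential mu (X j t)).
    by rewrite leNgt; apply/negP => h; exact: npot.
  have W3 : 3 * c <= normc (a +i* b).
    have h1 := leB_normc (potential mu (X j t)) (a +i* b).
    have := normc_le_ReIm (potential mu (X j t) - (a +i* b)).
    have -> : complex.Re (potential mu (X j t) - (a +i* b)) =
        complex.Re (potential mu (X j t)) - a by case: (potential mu (X j t)).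
    have -> : complex.Im (potential mu (X j t) - (a +i* b)) =
        complex.Im (potential mu (X j t)) - b by case: (potential mu (X j t)).
    move: h1 hre him V5 => *; lra.
  have dev (g : R[i] * R[i] -> R) : deviation mu X g j t =
      \sum_(k < n | k != j) g (X j t, X k t) - m * cond_mean mu g (X j t).
    rewrite /deviation sumrB; congr (_ - _).
    by rewrite sumr_const cardC1 card_ord mulr_natl.
  have hre2 : `|deviation mu X (far_re M) j t| < c * m.
    by rewrite ltNge; apply/negP.
  have him2 : `|deviation mu X (far_im M) j t| < c * m.
    by rewrite ltNge; apply/negP.
  rewrite dev -/a in hre2; rewrite dev -/b in him2.
  set A := \sum_(k < n | k != j) far_re M (X j t, X k t) in hre2 *.
  set B := \sum_(k < n | k != j) far_im M (X j t, X k t) in him2 *.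
  have mW : 3 * c * m <= normc ((m * a) +i* (m * b)).
    have -> : (m * a) +i* (m * b) = m%:C * (a +i* b).
      by apply/eqP; rewrite eq_complex /= !mul0r subr0 addr0 !eqxx.
    rewrite normcM mulrC (_ : normc m%:C = m) ?ler_pM2l//.
    by rewrite /= expr0n addr0 sqrtr_sqr ger0_norm// ltW.
  have h1 := leB_normc ((m * a) +i* (m * b)) (A +i* B).
  have := normc_le_ReIm ((m * a) +i* (m * b) - (A +i* B)).
  have -> : complex.Re ((m * a) +i* (m * b) - (A +i* B)) = m * a - A by [].
  have -> : complex.Im ((m * a) +i* (m * b) - (A +i* B)) = m * b - B by [].
  rewrite distrC (distrC _ B).
  move: h1 hre2 him2 mW => *; lra.
- have -> : riesz_sum (X ^~ t) j = \sum_(k < n | k != j) far_sq M (X j t, X k t).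
    by apply: eq_bigr => k kj; rewrite /far_sq farP.
  have : \sum_(k < n | k != j) far_sq M (X j t, X k t) < (c * m) ^+ 2 / 32.
    by rewrite -lte_fin -sumEFin ltNge; apply/negP.
  lra.
Qed.

(** The bounds on the near energy control [large_near_potential] and
    [clustered]; the last hypothesis controls the three events that involve
    second moments of the truncated kernel. *)
Lemma bad_event_rare (e : R) : 0 < e ->
  (mu [set z | (normc (potential mu z) < 5 * c)%R] <= e%:E)%E ->
  (near_energy mu M <= (c * e)%:E)%E -> (near_energy mu M <= (M / m * e)%:E)%E ->
  32 * (M / m * E) <= c ^+ 2 * e ->
  rare P (6 * e) bad_event.
Proof.
move=> e0 hV hc hM hE.
have le_rare a b A : a <= b -> rare P a A -> rare P b A.
  by move=> ab [mA PA]; split => //; rewrite (le_trans PA)// lee_fin.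
have -> : 6 * e = e + e + (e + e) + (e + e) by ring.
have EM : M * E <= m * (c ^+ 2 * e / 32).
  have -> : M * E = m * (M / m * E) by field; rewrite gt_eqF.
  by rewrite ler_pM2l// ler_pdivlMr// mulrC.
have ME0 : 0 <= M * E by rewrite mulr_ge0// ltW.
apply: rareU; first apply: rareU; first apply: rareU; try apply: rareU.
- apply: (le_rare _ _ _ _ (pair_sum_markov iX dX j (measurable_near_riesz M)
    (near_riesz_ge0 M) M0 hM)).
  by rewrite le_eqVlt; apply/orP; left; apply/eqP; field; rewrite !gt_eqF.
- have cm0 : 0 < (c * m) ^+ 2 / 32 by rewrite divr_gt0// exprn_gt0// mulr_gt0.
  have mq : measurable_fun setT (fun u : R[i] * R[i] => (far_sq M u)%:E).
    by apply/measurable_EFinP; exact: measurable_far_sq.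
  apply: (le_rare _ _ _ _ (pair_sum_markov iX dX j mq _ cm0
    (far_sq_integral M0 (measurable_far_sq M) _))).
  + rewrite -/m ler_pdivrMl//; apply: (le_trans (ler_wpM2l (ltW m0) EM)).
    by rewrite le_eqVlt; apply/orP; left; apply/eqP; field.
  + by move=> u; rewrite lee_fin far_sq_ge0.
  + by move=> u; rewrite far_sq_ge0 lexx.
- have qre : (\int[mu]_z \int[mu]_w (far_re M (z, w) ^+ 2)%:E <= (M * E)%:E)%E.
    apply: (far_sq_integral (f := fun u => far_re M u ^+ 2) M0).
      by apply: measurable_funX; exact: measurable_far_re.
    by move=> u; rewrite sqr_ge0 far_re_sq.
  have := weak_law_rare iX dX j n1 c0 (measurable_far_re M)
    (fun u => far_re_bounded u M0) qre.
  apply: le_rare.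
  rewrite -/m ler_pdivrMl ?mulr_gt0 ?exprn_gt0//; apply: (le_trans EM).
  have : 0 <= m * (c ^+ 2 * e) by rewrite !mulr_ge0// ?ltW// exprn_gt0.
  lra.
- have qim : (\int[mu]_z \int[mu]_w (far_im M (z, w) ^+ 2)%:E <= (M * E)%:E)%E.
    apply: (far_sq_integral (f := fun u => far_im M u ^+ 2) M0).
      by apply: measurable_funX; exact: measurable_far_im.
    by move=> u; rewrite sqr_ge0 far_im_sq.
  have := weak_law_rare iX dX j n1 c0 (measurable_far_im M)
    (fun u => far_im_bounded u M0) qim.
  apply: le_rare.
  rewrite -/m ler_pdivrMl ?mulr_gt0 ?exprn_gt0//; apply: (le_trans EM).
  have : 0 <= m * (c ^+ 2 * e) by rewrite !mulr_ge0// ?ltW// exprn_gt0.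
  lra.
- apply: single_rare hV => //.
  rewrite -[X in measurable X]setTI.
  exact: (measurable_fun_ltr (measurable_normc_potential energy_fin) (measurable_cst _)).
- have mnp := @measurable_near_potential _ mu M.
  have mA : measurable [set z | (c%:E <= near_potential mu M z)%E].
    exact: measurable_ge_set.
  apply: (single_rare dX j mA).
  apply: (le_trans (markov_ge0 _ mnp (near_potential_ge0 mu M) c0)).
  rewrite -(mulKf (lt0r_neq0 c0) e) EFinM lee_wpmul2l// lee_fin invr_ge0.
  exact: ltW.
Qed.

End fixed_index.

(** The constants are chosen in this order: c makes small values of V rare, tau
    makes the second moments of the truncated kernel small against c^2, and n is
    so large that M = tau * n.-1 makes the near energy negligible. *)
Lemma bad_index_rare (e : R) : 0 < e ->
  exists2 c, 0 < c & exists N, forall n, (N <= n)%N -> forall j : 'I_n,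
    exists2 A : set T, rare P e A &
      forall t, ~ A t -> good (X ^~ t) (c * n.-1%:R) j.
Proof.
move=> e0; pose e6 := e / 6; have e60 : 0 < e6 by rewrite divr_gt0.
have [c5 c50 hc5] := small_potential_rare energy_fin V0 e60.
pose c := c5 / 5; have c0 : 0 < c by rewrite divr_gt0.
have c5E : 5 * c = c5 by rewrite /c; field.
have E1 : 0 < E + 1 by rewrite ltr_wpDl.
pose tau := c ^+ 2 * e6 / (32 * (E + 1)).
have tau0 : 0 < tau by rewrite divr_gt0 ?mulr_gt0// exprn_gt0.
have [M1 M10 hM1] := near_energy_small energy_fin (mulr_gt0 c0 e60).
have [M2 M20 hM2] := near_energy_small energy_fin (mulr_gt0 tau0 e60).
exists c => //; exists (Num.truncn ((M1 + M2) / tau)).+2 => n nN j.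
have n1 : (1 < n)%N by rewrite (leq_trans _ nN).
have m0 : 0 < n.-1%:R :> R by rewrite ltr0n -subn1 subn_gt0.
have Mle : M1 + M2 <= tau * n.-1%:R.
  rewrite mulrC -ler_pdivrMr// (le_trans (ltW (truncnS_gt _)))// ler_nat.
  by rewrite -ltnS prednK// ltnW.
have M0 : 0 < tau * n.-1%:R by rewrite mulr_gt0.
exists (bad_event j c (tau * n.-1%:R)); last first.
  by move=> t; exact: bad_event_good.
have -> : e = 6 * e6 by rewrite /e6; field.
apply: bad_event_rare => //.
- by rewrite c5E.
- by apply: hM1; rewrite (le_trans _ Mle)// lerDl ltW.
- by rewrite mulfK ?gt_eqF//; apply: hM2; rewrite (le_trans _ Mle)// lerDr ltW.
- rewrite mulfK ?gt_eqF//.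
  have -> : 32 * (tau * E) = c ^+ 2 * e6 * (E / (E + 1)) by rewrite /tau; field; rewrite gt_eqF.
  apply: ler_piMr; first by rewrite mulr_ge0 ?sqr_ge0// ltW.
  by rewrite ler_pdivrMr// mul1r lerDl.
Qed.

End bad_indices.

(** * Convergence in probability *)
Lemma ge0_ereal_cvg0 {R : realType} (u : (\bar R)^nat) :
  (forall n, (0 <= u n)%E) ->
  (forall e : R, 0 < e -> exists N, forall n, (N <= n)%N -> (u n <= e%:E)%E) ->
  u n @[n --> \oo] --> 0%E.
Proof.
move=> u0 hu; apply/fine_cvgP; split.
  have [N hN] := hu 1 ltr01; exists N => // n /= Nn.
  by rewrite ge0_fin_numE// (le_lt_trans (hN n Nn))// ltry.
apply/cvgrPdist_le => e e0; have [N hN] := hu e e0; exists N => // n /= Nn.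
rewrite sub0r normrN ger0_norm ?fine_ge0//.
have fu : u n \is a fin_num by rewrite ge0_fin_numE// (le_lt_trans (hN n Nn))// ltry.
by rewrite -lee_fin fineK// hN.
Qed.

Section rare_unions.
Context d (T : measurableType d) {R : realType} (P : probability T R).

Lemma rare_bigcup (I : Type) (s : seq I) (a : I -> R) (A : I -> set T) :
  (forall i, rare P (a i) (A i)) ->
  rare P (\sum_(i <- s) a i) (\big[setU/set0]_(i <- s) A i).
Proof.
move=> h; elim: s => [|i s IH]; last by rewrite !big_cons; exact: rareU.
by rewrite !big_nil; split; rewrite ?measure0.
Qed.

(** Markov's inequality for the number of the events A j that occur. *)
Lemma count_rare (n : nat) (A : 'I_n -> set T) (a b : R) : 0 < b ->
  (forall j, rare P a (A j)) ->
  rare P (b^-1 * (n%:R * a)) [set t | b <= \sum_(j < n) \1_(A j) t].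
Proof.
move=> b0 hA.
have -> : [set t | b <= \sum_(j < n) \1_(A j) t] =
    [set t | (b%:E <= \sum_(j < n) (\1_(A j) t)%:E)%E].
  by apply/seteqP; split => t /=; rewrite sumEFin lee_fin.
have m1 j : measurable_fun setT (fun t => (\1_(A j) t : R)%:E).
  by apply/measurable_EFinP; apply: measurable_indic; have [] := hA j.
have ms : measurable_fun setT (fun t => \sum_(j < n) (\1_(A j) t : R)%:E)%E.
  exact: emeasurable_sum.
split; first exact: measurable_ge_set.
apply: (le_trans (markov_ge0 _ ms _ b0)) => [t|]; first by apply: sume_ge0 => j _; rewrite lee_fin.
rewrite EFinM lee_wpmul2l ?lee_fin ?invr_ge0 ?(ltW b0)//.
rewrite ge0_integral_sum//.
apply: (@le_trans _ _ (\sum_(j < n) a%:E)%E); last first.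
  by rewrite sumEFin lee_fin sumr_const card_ord mulr_natl.
apply: lee_sum => j _; have [mA PA] := hA j.
by rewrite integral_indic// setIT.
Qed.

End rare_unions.

Lemma cover_full {R : realType} (mu : probability R[i] R) (r e : R) :
  0 < r -> 0 < e -> exists K, (mu (~` rat_cover K r) <= e%:E)%E.
Proof.
move=> r0 e0; pose A K : set R[i] := ~` rat_cover K r.
have cap0 : mu (\bigcap_K A K) = 0%E.
  rewrite (_ : \bigcap_K A K = set0) ?measure0//.
  apply/seteqP; split => // z h.
  have [k hk] := rat_point_dense z r0.
  by apply: (h k.+1 I); exists k => //=.
have /ereal_cvg0_le /(_ e0)[N hN] : mu (A n) @[n --> \oo] --> 0%E.
  rewrite -cap0; apply: (@nonincreasing_cvg_mu _ _ _ mu A) => //.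
  - rewrite (le_lt_trans (probability_le1 _ _)) ?ltry//.
    by apply: measurableC; exact: measurable_rat_cover.
  - by move=> i; apply: measurableC; exact: measurable_rat_cover.
  - apply: bigcap_measurableType => i _; apply: measurableC; exact: measurable_rat_cover.
  - move=> i j ij; apply/subsetPset; apply: subsetC => z [k /= ki zk].
    by exists k => //=; exact: leq_trans ij.
by exists N; exact: hN.
Qed.

Section main.
Context {R : realType} (mu : probability R[i] R)
  d (T : measurableType d) (P : probability T R) (X : nat -> {RV P >-> R[i]}).
Hypotheses (iX : mutually_independent X) (dX : identically_distributed X mu).

(** The weak law for the indicator of U; the point X 0 only serves as the first
    variable of that law. *)
Lemma empirical_rare (n : nat) (U : set R[i]) (dl : R) : (1 < n)%N -> 0 < dl ->
  measurable U ->
  exists2 A : set T, rare P (dl ^+ 2 * n.-1%:R)^-1 A & forall t, ~ A t ->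
    (mu U <= (#|[set j : 'I_n | `[< U (X j t) >]]%SET|%:R / n.-1%:R + dl)%:E)%E.
Proof.
move=> n1 dl0 mU; have m0 : 0 < n.-1%:R :> R by rewrite ltr0n -subn1 subn_gt0.
pose j0 : 'I_n := Ordinal (ltnW n1).
pose g (u : R[i] * R[i]) : R := \1_U u.2.
have mg : measurable_fun setT g.
  by apply: measurableT_comp; [exact: measurable_indic|exact: measurable_snd].
have g1 u : `|g u| <= 1 by rewrite /g indicE ger0_norm// lern1 leq_b1.
have q1 : (\int[mu]_z \int[mu]_w (g (z, w) ^+ 2)%:E <= 1%:E)%E.
  rewrite -[leRHS](probability_integral_cst mu 1).
  have msq : measurable_fun setT (fun u => (g u ^+ 2)%:E).
    by apply/measurable_EFinP; exact: measurable_funX.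
  apply: ge0_le_integral => //.
  - by move=> z _; apply: integral_ge0 => w _; rewrite lee_fin sqr_ge0.
  - apply: (@measurable_fun_fubini_tonelli_F _ _ _ _ _ mu (fun u => (g u ^+ 2)%:E)) => // u.
    by rewrite lee_fin sqr_ge0.
  move=> z _; rewrite -[leRHS](probability_integral_cst mu 1).
  apply: ge0_le_integral => //.
  - by move=> w _; rewrite lee_fin sqr_ge0.
  - exact: (measurableT_comp msq (measurable_pair1 z)).
  - move=> w _; rewrite lee_fin -real_normK ?num_real//.
    by rewrite expr_le1.
have hA := weak_law_rare iX dX j0 n1 dl0 mg g1 q1; rewrite mulr1 in hA.
eexists; first exact: hA.
move=> t /negP; rewrite /= -ltNge => dev.
have fU : mu U \is a fin_num by exact: fin_num_measure.
rewrite -(fineK fU) lee_fin.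
have cmE z : cond_mean mu g z = fine (mu U).
  by rewrite /cond_mean /g /Rintegral /= integral_indic// setIT.
have devE : deviation mu X g j0 t =
    \sum_(k < n | k != j0) \1_U (X k t) - n.-1%:R * fine (mu U).
  rewrite /deviation sumrB; congr (_ - _).
  under eq_bigr do rewrite cmE.
  by rewrite sumr_const cardC1 card_ord mulr_natl.
have cnt : \sum_(k < n | k != j0) \1_U (X k t) <=
    #|[set j : 'I_n | `[< U (X j t) >]]%SET|%:R :> R.
  rewrite -sum1_card natr_sum [leRHS]big_mkcond/= [leLHS]big_mkcond/=.
  apply: ler_sum => k _; rewrite inE indicE.
  have -> : (X k t \in U) = `[< U (X k t) >] by apply/idP/asboolP; rewrite inE.
  by case: (k != j0) => /=; case: (`[< _ >]).
rewrite -lerBlDr ler_pdivlMr//.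
move: dev; rewrite devE ltr_norml => /andP[+ _].
rewrite mulrBl; move: cnt; lra.
Qed.

Hypothesis energy_fin : (energy1 mu < +oo)%E.
Hypothesis V0 : mu [set z | potential mu z = 0] = 0%E.

Lemma prohorov_nodal_rare (e h : R) : 0 < e -> 0 < h ->
  exists N, forall n, (N <= n)%N ->
    (P [set t | (e < prohorov (root_measure (nodal n (X ^~ t))^`()) mu)%R] <= h%:E)%E.
Proof.
move=> e0 h0; pose dl := e / 3; have dl0 : 0 < dl by rewrite divr_gt0.
have [K hK] := cover_full mu (divr_gt0 e0 (ltr0n R 4 : 0 < 4)) dl0.
have eps0 : 0 < dl * h / 4 by rewrite divr_gt0// mulr_gt0.
have [c c0 [N1 hN1]] := bad_index_rare energy_fin V0 iX dX eps0.
pose Q : R := #|{set 'I_K}|%:R.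
have Q0 : 0 <= Q by [].
(* The first term makes the union bound over the Q unions of balls at most h/2,
   the second one makes the radius 2 / (c * n.-1) at most e/4. *)
pose b := Q * 2 / (dl ^+ 2 * h) + 8 / (e * c).
exists (maxn N1 (Num.truncn b).+2) => n; rewrite geq_max => /andP[nN1 nN2].
have n1 : (1 < n)%N by rewrite (leq_trans _ nN2).
have m0 : 0 < n.-1%:R :> R by rewrite ltr0n -subn1 subn_gt0.
have bm : b <= n.-1%:R.
  rewrite (le_trans (ltW (truncnS_gt _)))// ler_nat.
  by rewrite -ltnS prednK// ltnW.
have b1 : 0 <= Q * 2 / (dl ^+ 2 * h) by rewrite divr_ge0 ?mulr_ge0 ?sqr_ge0// ltW.
have b2 : 0 < 8 / (e * c) by rewrite divr_gt0// mulr_gt0.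
have /choice[A hA] : forall j : 'I_n, exists A : set T, rare P (dl * h / 4) A /\
    forall t, ~ A t -> good (X ^~ t) (c * n.-1%:R) j.
  by move=> j; have [A rA gA] := hN1 n nN1 j; exists A.
have /choice[B hB] : forall I : {set 'I_K}, exists B : set T,
    rare P (dl ^+ 2 * n.-1%:R)^-1 B /\ forall t, ~ B t ->
    (mu (rat_subcover (e / 4) I) <=
     (#|[set j : 'I_n | `[< rat_subcover (e / 4) I (X j t) >]]%SET|%:R / n.-1%:R + dl)%:E)%E.
  move=> I; have [B rB gB] := empirical_rare n1 dl0 (measurable_rat_subcover (e / 4) I).
  by exists B.
pose Bad1 : set T := [set t | dl * n.-1%:R <= \sum_(j < n) \1_(A j) t].
pose Bad2 : set T := \big[setU/set0]_(I <- enum {set 'I_K}) B I.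
have r1 : rare P ((dl * n.-1%:R)^-1 * (n%:R * (dl * h / 4))) Bad1.
  by apply: count_rare; [exact: mulr_gt0|move=> j; have [] := hA j].
have r2 : rare P (\sum_(I <- enum {set 'I_K}) (dl ^+ 2 * n.-1%:R)^-1) Bad2.
  by apply: rare_bigcup => I; have [] := hB I.
have [mBad PBad] := rareU r1 r2.
apply: (@le_trans _ _ (P (Bad1 `|` Bad2))).
  apply: le_measure; rewrite ?inE//.
    have mX k : measurable_fun setT (X k : T -> R[i]) by exact: measurable_funP.
    exact: (measurable_prohorov_gt mX e (probability_setT mu) n1).
  move=> t /= et; apply: contrapT => nt; move: et; apply/negP; rewrite -leNgt.
  have nb1 : ~ Bad1 t by move=> ?; apply: nt; left.
  have nb2 I : ~ B I t.
    move=> BI; apply: nt; right; rewrite /Bad2 -bigcup_seq; exists I => //=.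
    by rewrite mem_enum.
  apply: (@prohorov_nodal_le _ mu _ n (X ^~ t) K (c * n.-1%:R) e dl) => //.
  - exact: probability_setT.
  - exact: mulr_gt0.
  - by rewrite /dl mulrC divfK.
  - rewrite ler_pdivrMr ?mulr_gt0//.
    have : 8 / (e * c) <= n.-1%:R by rewrite (le_trans _ bm)// lerDr.
    rewrite ler_pdivrMr ?mulr_gt0//; lra.
  - by move=> I; have [_] := hB I; apply.
  - apply: ltW; move: nb1; rewrite /Bad1 /= => /negP; rewrite -ltNge; apply: le_lt_trans.
    rewrite -sum1_card natr_sum big_mkcond/=; apply: ler_sum => j _.
    rewrite inE indicE; case: asboolP => //= ng.
    rewrite mem_set//; apply: contrapT => nA; apply: ng.
    by have [_] := hA j; apply.
apply: (le_trans PBad); rewrite lee_fin [h in leRHS]splitr lerD//.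
  rewrite ler_pdivrMl ?mulr_gt0//.
  have : n%:R <= 2 * n.-1%:R :> R.
    by rewrite -natrM ler_nat mul2n -addnn -{1}(prednK (ltnW n1)) -add1n leq_add2r
       -ltnS prednK // ltnW.
  move=> n2; apply: (@le_trans _ _ (2 * n.-1%:R * (dl * h / 4))).
    by rewrite ler_wpM2r// ltW.
  by rewrite le_eqVlt; apply/orP; left; apply/eqP; field.
rewrite big_const_seq count_predT -cardE iter_addr_0 -[leLHS]mulr_natl -/Q.
rewrite ler_pdivrMr ?mulr_gt0 ?exprn_gt0//.
have : Q * 2 / (dl ^+ 2 * h) <= n.-1%:R by rewrite (le_trans _ bm)// lerDl ltW.
rewrite ler_pdivrMr ?mulr_gt0 ?exprn_gt0//; lra.
Qed.

End main.

Theorem theorem2p2 (R : realType) (mu : probability R[i] R)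
    (d : measure_display) (T : measurableType d) (P : probability T R)
    (X : nat -> {RV P >-> R[i]}) :
  (energy1 mu < +oo)%E ->
  mu [set z | potential mu z = 0] = 0%E ->
  mutually_independent X ->
  identically_distributed X mu ->
  cvg_in_probability P
    (fun n t => prohorov (root_measure (random_poly X n t)^`()) mu) 0.
Proof.
move=> energy_fin V0 iX dX e e0; apply: ge0_ereal_cvg0 => // h h0.
have [N hN] := prohorov_nodal_rare iX dX energy_fin V0 e0 h0.
exists N => n /hN; apply: le_trans; rewrite le_eqVlt; apply/orP; left; apply/eqP.
congr (P _); apply/seteqP; split => t /=; rewrite subr0 ger0_norm ?prohorov_ge0//.
Qed.
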